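(* Fix an integer $K \geq 1$ and positive integers $d_i, M_i, N_i$ for $1 \leq i \leq K$. Let $\mathcal H = \prod_{1 \leq i \neq j \leq K} \mathbb{C}^{N_i \times M_j}$ be the space of tuples $h = (H_{ij})_{i \neq j}$ of cross-channel matrices, and for $h \in \mathcal H$ let $\mathcal F(h)$ denote the variety of feasible strategies for $h$. Then for generic $h \in \mathcal H$ the following hold. (1) If $\mathcal F(h) \neq \varnothing$, then $$\dim \mathcal F(h) = \sum_{i=1}^K \big(d_i(N_i - d_i) + d_i(M_i - d_i)\big) - \sum_{1 \leq i, j \leq K,\ j \neq i} d_i d_j.$$ In particular, if this quantity is negative, then $\mathcal F(h) = \varnothing$. (2) If $\mathcal F(h) \neq \varnothing$, then $d_i \leq \min(M_i, N_i)$ for all $i$; moreover $d_i + d_j \leq \max\{N_i, M_j\}$ for all $1 \leq i \neq j \leq K$; and for every subset $A \subset \{1, \ldots, K\}$ the quantity $$t_A := \sum_{i \in A} \big(d_i(N_i - d_i) + d_i(M_i - d_i)\big) - \sum_{i, j \in A,\ i \neq j} d_i d_j$$ is non-negative.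
   Context: This concerns the $K$-user MIMO interference channel: transmitter $j$ has $M_j$ antennas, receiver $i$ has $N_i$ antennas, and the cross channel from transmitter $j$ to receiver $i$ ($i \neq j$) is a matrix $H_{ij} \in \mathbb{C}^{N_i \times M_j}$. For $h = (H_{ij})_{i\neq j}$, a feasible strategy (with signal dimensions $d_1,\dots,d_K$) is a tuple $(U_1, \ldots, U_K, V_1, \ldots, V_K)$ where $U_i \subseteq \mathbb{C}^{M_i}$ and $V_i \subseteq \mathbb{C}^{N_i}$ are linear subspaces of dimension $d_i$, such that $v^T H_{ij} u = 0$ for all $v \in V_i$, $u \in U_j$, and all $i \neq j$ (i.e. $V_i$, viewed as functionals, annihilates $H_{ij}U_j$). The variety of feasible strategies $\mathcal F(h)$ is the set of such tuples, viewed as a closed subvariety of the product of Grassmannians $\prod_{i=1}^K G(d_i, M_i) \times \prod_{i=1}^K G(d_i, N_i)$, where $G(d,n)$ is the Grassmannian of $d$-dimensional subspaces of $\mathbb{C}^n$. Its dimension is the maximum dimension of its irreducible components. A statement holds ''for generic $h$'' if it holds for all $h$ in some nonempty Zariski-open (hence dense) subset of $\mathcal H$. *)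

(* Defs.v *)
From HB Require Import structures.
From mathcomp Require Import all_boot all_order all_algebra.
From mathcomp Require Import reals.
From mathcomp Require Import complex.
Set Implicit Arguments. Unset Strict Implicit. Unset Printing Implicit Defensive.
Import Order.TTheory GRing.Theory Num.Theory.
Local Open Scope ring_scope.

Section Generic.
Variable F : fieldType.

Inductive polyfun (T : Type) (coords : (T -> F) -> Prop) : (T -> F) -> Prop :=
| pf_coord f : coords f -> polyfun coords f
| pf_const (c : F) : polyfun coords (fun _ => c)
| pf_add f g : polyfun coords f -> polyfun coords g ->
    polyfun coords (fun x => f x + g x)
| pf_mul f g : polyfun coords f -> polyfun coords g ->
    polyfun coords (fun x => f x * g x).

Section Topo.
Variable P : Type.
Variable closed : (P -> Prop) -> Prop.
Variable Y : P -> Prop.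

Definition subsetP (A B : P -> Prop) := forall x, A x -> B x.
Definition psubsetP (A B : P -> Prop) := subsetP A B /\ exists x, B x /\ ~ A x.
Definition nonemptyP (A : P -> Prop) := exists x, A x.

Definition closed_in (Z : P -> Prop) :=
  exists W, closed W /\ forall x, Z x <-> (Y x /\ W x).

Definition irreducible_in (Z : P -> Prop) :=
  closed_in Z /\ nonemptyP Z /\
  forall Z1 Z2, closed_in Z1 -> closed_in Z2 -> subsetP Z1 Z -> subsetP Z2 Z ->
    (forall x, Z x -> Z1 x \/ Z2 x) -> subsetP Z Z1 \/ subsetP Z Z2.

Definition irr_chain (n : nat) :=
  exists Z : nat -> P -> Prop,
    (forall k, (k <= n)%N -> irreducible_in (Z k)) /\
    (forall k, (k < n)%N -> psubsetP (Z k) (Z k.+1)).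

Definition krull_dim (n : nat) := irr_chain n /\ ~ irr_chain n.+1.
End Topo.
End Generic.

Section IC.
Variable R : realType.
Local Notation C := (R[i]).
Variable K : nat.
Variables (d M N : 'I_K -> nat).

(** cross channels: h i j : C^{N_i x M_j}; only the entries with i != j are
    coordinates of the parameter space (diagonal entries are never used). *)
Definition hspace := forall i j : 'I_K, 'M[C]_(N i, M j).

Definition hcoords (f : hspace -> C) : Prop :=
  exists (i j : 'I_K) (a : 'I_(N i)) (b : 'I_(M j)),
    i != j /\ f = (fun h => h i j a b).

Definition generic (Pr : hspace -> Prop) : Prop :=
  exists f, polyfun hcoords f /\ (exists h, f h != 0) /\
    forall h, f h != 0 -> Pr h.

(** Points of prod_i G(d_i, M_i) x prod_i G(d_i, N_i): each subspace of C^n is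
    represented by its canonical square matrix <<A>>%MS whose row space is it. *)
Record strat := Strat {
  SU : forall i : 'I_K, 'M[C]_(M i);
  SV : forall i : 'I_K, 'M[C]_(N i) }.

Definition is_point (p : strat) : Prop :=
  forall i, (<<SU p i>>%MS = SU p i /\ \rank (SU p i) = d i) /\
            (<<SV p i>>%MS = SV p i /\ \rank (SV p i) = d i).

Definition stiefel := ((forall i : 'I_K, 'M[C]_(d i, M i)) *
                       (forall i : 'I_K, 'M[C]_(d i, N i)))%type.

Definition is_stiefel (X : stiefel) : Prop :=
  forall i, row_free (X.1 i) /\ row_free (X.2 i).

Definition stiefel_proj (X : stiefel) : strat :=
  Strat (fun i => <<X.1 i>>%MS) (fun i => <<X.2 i>>%MS).

Definition scoords (f : stiefel -> C) : Prop :=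
  (exists i (a : 'I_(d i)) (b : 'I_(M i)), f = (fun X => X.1 i a b)) \/
  (exists i (a : 'I_(d i)) (b : 'I_(N i)), f = (fun X => X.2 i a b)).

(** Zariski topology on the product of Grassmannians: the quotient topology of
    the Zariski topology on the Stiefel variety (an open subset of affine space):
    Z is closed iff its preimage is the Stiefel variety cut by polynomials. *)
Definition grass_closed (Z : strat -> Prop) : Prop :=
  (forall p, Z p -> is_point p) /\
  exists Fs : (stiefel -> C) -> Prop,
    (forall f, Fs f -> polyfun scoords f) /\
    forall X, is_stiefel X ->
      (Z (stiefel_proj X) <-> forall f, Fs f -> f X = 0).

Definition feasible (h : hspace) (p : strat) : Prop :=
  is_point p /\
  forall i j : 'I_K, i != j ->
    forall (v : 'rV[C]_(N i)) (u : 'rV[C]_(M j)),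
      (v <= SV p i)%MS -> (u <= SU p j)%MS -> v *m h i j *m u^T = 0.

Definition variety_dim (Y : strat -> Prop) (n : int) : Prop :=
  exists m : nat, n = m%:Z /\ krull_dim grass_closed Y m.

Definition tA (A : {set 'I_K}) : int :=
  \sum_(i in A) ((d i)%:Z * ((N i)%:Z - (d i)%:Z) + (d i)%:Z * ((M i)%:Z - (d i)%:Z))
  - \sum_(i in A) \sum_(j in A | j != i) ((d i)%:Z * (d j)%:Z).

Definition expected_dim : int := tA [set: 'I_K].

End IC.

(* Main.v *)
Require Import Defs.
From HB Require Import structures.
From mathcomp Require Import all_boot all_order all_algebra.
From mathcomp Require Import reals complex.
From mathcomp Require Import mpoly ring zify.
From mathcomp Require classical_sets.
From Stdlib Require Import Classical FunctionalExtensionality.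
Import Order.TTheory GRing.Theory Num.Theory.
Local Open Scope ring_scope.
Set Implicit Arguments. Unset Strict Implicit. Unset Printing Implicit Defensive.

(** Over a chart of the product of Grassmannians the incidence variety of pairs
    (channel, strategy) is an affine space of dimension n: normalizing the bases so
    that d_i chosen columns form an identity matrix, the equations V_i H_ij U_j^T = 0
    express the d_i d_j pivot entries of H_ij through all the others. The feasible
    strategies for h in the chart are then the fiber over h of a polynomial map phi
    from n-space to m-space, with n - m the expected dimension.

    If phi is not dominant, a polynomial relation between its components rules out
    all generic fibers. Otherwise a relative Noether normalization over the field of
    rational functions of the target yields y_1, ..., y_r such that, away from a
    hypersurface f = 0 of the target, every polynomial is integral over C[phi, y].
    Counting monomials gives r = n - m, and shows that no r + 1 polynomials are
    algebraically independent on a fiber, whereas a chain of k + 1 irreducible closed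
    sets provides k independent ones. Conversely, ideals that are maximal among those
    whose trace on C[phi, y] vanishes on {h} x L_i, for a flag of linear subspaces L_i,
    define by lying over a chain of r + 1 irreducible closed subsets of the fiber.

    The inequality t_A >= 0 is the dimension formula applied with d_i replaced by 0
    outside A. *)

(** * Substitutions and nonvanishing *)

(** The topology on the Grassmannians is global while the algebra lives on charts. The bridge is
    that an irreducible closed set is determined by its trace on any chart that it meets: a chain
    can be read on a chart around a point of its smallest member, and closures of sets in a chart
    form a chain of feasible strategies. As [n - m] is the same for all charts, one chart containing
    a strategy gives the lower bound and all charts together the upper one; finitely many charts
    exclude finitely many hypersurfaces.

    Integrality is expressed by multiplication operators on a finite family [w] containing 1, up to
    powers of one denominator. The same data feeds the monomial counts and the determinants of
    Nakayama and Cayley-Hamilton type. The denominator has to come from the target alone, since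
    otherwise it could vanish on a whole fiber; hence the relative normalization. Maximality of the
    ideals over the flag stands in for going-down, so that lying over suffices.

    The bound on [d_i + d_j] is separate: a generic [H_ij] has full rank, and Sylvester's rank
    inequality applies. *)

Lemma mpoly_ring_ind n (R : comNzRingType) (P : {mpoly R[n]} -> Prop) :
  (forall c, P c%:MP) -> (forall i, P 'X_i) ->
  (forall p q, P p -> P q -> P (p + q)) ->
  (forall p q, P p -> P q -> P (p * q)) -> forall p, P p.
Proof.
move=> PC PX PD PM; elim/mpolyind => [|c m p _ _ Pp]; first by rewrite -mpolyC0.
apply: (PD) => //; rewrite -mul_mpolyC; apply: (PM) => //.
rewrite mpolyXE_id; apply: (big_ind P) => [||i _]; [exact: (PC 1)|exact: PM|].
elim: (m i) => [|e IHe]; first exact: (PC 1).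
by rewrite exprS; apply: (PM).
Qed.

Lemma rmorph_mpoly_eq n (R : comNzRingType) (B : pzRingType)
    (f g : {rmorphism {mpoly R[n]} -> B}) :
  (forall c, f c%:MP = g c%:MP) -> (forall i, f 'X_i = g 'X_i) -> f =1 g.
Proof.
move=> eqC eqX; elim/mpoly_ring_ind => // p q fp fq.
  by rewrite !rmorphD /= fp fq.
by rewrite !rmorphM /= fp fq.
Qed.

Section Kronecker.
Variable D : nat.

Lemma digits_inj k (a b : 'I_k -> nat) :
  (forall i, a i < D)%N -> (forall i, b i < D)%N ->
  (\sum_i a i * D ^ i = \sum_i b i * D ^ i)%N -> a =1 b.
Proof.
elim: k a b => [|k IH] a b aD bD; first by move=> _ [].
rewrite !big_ord_recl /= expn0 !muln1.
have E (c : 'I_k.+1 -> nat) : (\sum_(i < k) c (lift ord0 i) * D ^ bump 0 i =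
     (\sum_(i < k) c (lift ord0 i) * D ^ i) * D)%N.
  by rewrite big_distrl /=; apply: eq_bigr => i _; rewrite /bump add1n expnSr mulnA.
rewrite !E => eq_ab.
have D0 : (0 < D)%N by apply: leq_trans (aD ord0).
have eq0 : a ord0 = b ord0.
  by have /(congr1 (modn^~ D)) := eq_ab; rewrite ![(_ ord0 + _)%N]addnC !modnMDl !modn_small.
have eqS : (\sum_(i < k) a (lift ord0 i) * D ^ i = \sum_(i < k) b (lift ord0 i) * D ^ i)%N.
  apply/eqP; rewrite -(eqn_pmul2r D0); apply/eqP.
  by apply/(@addnI (a ord0)); rewrite eq_ab eq0.
move=> i; case: (unliftP ord0 i) => [j ->|-> //].
by apply: (IH (fun j => a (lift ord0 j)) (fun j => b (lift ord0 j))).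
Qed.

Definition kwt k (m : 'X_{1..k}) := (\sum_i m i * D ^ i)%N.

(* A substitution of monic univariate polynomials of degrees D^i gives distinct
   degrees to the monomials with exponents below D. *)
Lemma kronecker_lead (S : nzRingType) (R : idomainType) (t : {rmorphism S -> R}) k
    (h : 'I_k -> {poly R}) (P : {mpoly S[k]}) :
  (forall i, h i \is monic) -> (forall i, size (h i) = (D ^ i).+1) ->
  P != 0 -> (forall m, m \in msupp P -> forall i, m i < D)%N ->
  exists2 m0, m0 \in msupp P &
    (mmap (polyC \o t) h P)`_(kwt m0) = t P@_m0 /\
    (size (mmap (polyC \o t) h P) <= (kwt m0).+1)%N.
Proof.
move=> hm hs P0 PD.
have szX m : mmap1 h m \is monic /\ size (mmap1 h m) = (kwt m).+1.
  have mn : mmap1 h m \is monic by apply: monic_prod => i _; apply: monic_exp.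
  split=> //; rewrite /mmap1 size_prod; last first.
    by move=> i _; apply/expf_neq0/monic_neq0.
  have -> : (\sum_(i < k) size (h i ^+ m i) = \sum_(i < k) (m i * D ^ i + 1))%N.
    apply: eq_bigr => i _; rewrite addn1 -[LHS]prednK; last first.
      by rewrite size_poly_gt0 expf_neq0 // monic_neq0.
    by rewrite size_exp hs mulnC.
  by rewrite big_split /= sum1_card subSn ?leq_addl // addnK.
have [m0 m0P max0] : exists2 m0, m0 \in msupp P &
    forall m, m \in msupp P -> (kwt m <= kwt m0)%N.
  case E: (msupp P) => [|m1 s]; first by move: P0; rewrite -msupp_eq0 E.
  have [i _ /= maxi] := arg_maxnP (fun i : 'I_(size (m1 :: s)) => kwt (nth m1 (m1 :: s) i))
    (erefl true : predT (Ordinal (ltn0Sn (size s)))).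
  exists (nth m1 (m1 :: s) i); first exact: mem_nth.
  by move=> m /(nthP m1) [j js <-]; apply: (maxi (Ordinal js)).
exists m0 => //; rewrite /mmap; split.
  rewrite coef_sum (bigD1_seq m0) ?msupp_uniq //= coefCM.
  have [/monicP] := szX m0; rewrite lead_coefE => + sz; rewrite sz /= => ->.
  rewrite mulr1 big_seq_cond big1 ?addr0 // => m /andP[mP mm0].
  rewrite coefCM nth_default ?mulr0 // (szX m).2 ltn_neqAle max0 // andbT.
  apply: contra mm0 => /eqP /digits_inj eqm; apply/eqP/mnmP/eqm; exact: PD.
apply: leq_trans (size_sum _ _ _) _; apply/bigmax_leqP_seq => m mP _.
rewrite mul_polyC; apply: leq_trans (size_scale_leq _ _) _.
by rewrite (szX m).2 ltnS max0.
Qed.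
End Kronecker.

Lemma expo_bound (S : nzRingType) k (P : {mpoly S[k]}) :
  exists D, forall m, m \in msupp P -> forall i, (m i < D)%N.
Proof.
exists (msize P) => m mP i; apply: leq_ltn_trans (msize_mdeg_lt mP).
by rewrite mdegE (bigD1 i) //= leq_addr.
Qed.

Lemma poly_nonroot (F : numDomainType) (p : {poly F}) : p != 0 -> exists t, p.[t] != 0.
Proof.
move=> p0; apply: NNPP => all0.
have rt t : root p t by apply/negPn/negP => h; apply: all0; exists t.
(* In characteristic zero the naturals below [size p] are distinct: one root too many. *)
have := max_poly_roots (rs := [seq i%:R | i <- iota 0 (size p)]) p0.
rewrite size_map size_iota ltnn => /(_ _ _)/notF; apply.
  by apply/allP => x _; apply: rt.
by rewrite map_inj_uniq ?iota_uniq // => i j /eqP; rewrite eqr_nat => /eqP.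
Qed.

(** The substitution of [t ^ (D ^ i)] for the variables keeps [P] nonzero by [kronecker_lead], which
    reduces the claim to one variable. *)
Lemma mpoly_nonroot (F : numDomainType) n (P : {mpoly F[n]}) :
  P != 0 -> exists v, P.@[v] != 0.
Proof.
move=> P0; have [D PD] := expo_bound P.
have hm (i : 'I_n) : ('X^(D ^ i) : {poly F}) \is monic by apply: monicXn.
have hs (i : 'I_n) : size ('X^(D ^ i) : {poly F}) = (D ^ i).+1 by apply: size_polyXn.
have [m0 m0P [cf _]] := @kronecker_lead D F F idfun n _ P hm hs P0 PD.
set G := mmap _ _ _ in cf.
have G0 : G != 0.
  apply: contraL m0P => /eqP G0; rewrite -mcoeff_eq0.
  by rewrite /= in cf; rewrite -cf G0 coef0.
have [t Gt] := poly_nonroot G0; exists (fun i => t ^+ (D ^ i)).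
suff <- : G.[t] = P.@[fun i => t ^+ (D ^ i)] by [].
rewrite /G /meval /mmap horner_sum; apply: eq_bigr => m _.
rewrite /= hornerM hornerC; congr (_ * _); rewrite /mmap1 horner_prod.
by apply: eq_bigr => i _; rewrite !hornerE.
Qed.

(** * Modules finite up to powers of one denominator *)

Section FiniteUpTo.
Variables (R A : comNzRingType) (rho : {rmorphism R -> A}) (I : finType) (w : I -> A).

Definition inspan (a : A) := exists Q : I -> R, a = \sum_l rho (Q l) * w l.

(* Multiplication by p preserves the span of w once f is inverted. *)
Definition finmul (f : R) (p : A) := exists e, forall l, inspan (rho f ^+ e * p * w l).

Lemma inspan0 : inspan 0.
Proof. by exists (fun=> 0); rewrite big1 // => l _; rewrite rmorph0 mul0r. Qed.

Lemma inspan_base l : inspan (w l).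
Proof.
exists (fun l' => (l' == l)%:R); rewrite (bigD1 l) //= eqxx rmorph1 mul1r.
by rewrite big1 ?addr0 // => l' /negPf ->; rewrite rmorph0 mul0r.
Qed.

Lemma inspanD a b : inspan a -> inspan b -> inspan (a + b).
Proof.
move=> [Q ->] [Q' ->]; exists (fun l => Q l + Q' l); rewrite -big_split /=.
by apply: eq_bigr => l _; rewrite rmorphD mulrDl.
Qed.

Lemma inspanM c a : inspan a -> inspan (rho c * a).
Proof.
move=> [Q ->]; exists (fun l => c * Q l); rewrite mulr_sumr.
by apply: eq_bigr => l _; rewrite rmorphM mulrA.
Qed.

Lemma inspan_sum (J : Type) (s : seq J) (P : pred J) (a : J -> A) :
  (forall j, P j -> inspan (a j)) -> inspan (\sum_(j <- s | P j) a j).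
Proof. by move=> Pa; apply: big_ind => //; [exact: inspan0|exact: inspanD]. Qed.

Lemma inspan_exp f e e' a :
  (e <= e')%N -> inspan (rho f ^+ e * a) -> inspan (rho f ^+ e' * a).
Proof.
by move=> le_e H; rewrite -(subnK le_e) exprD -mulrA -rmorphXn; apply: inspanM.
Qed.

Lemma finmul_pointwise f p :
  (forall l, exists e, inspan (rho f ^+ e * p * w l)) -> finmul f p.
Proof.
move=> H; suff [e He] : exists e, forall l, l \in enum I -> inspan (rho f ^+ e * p * w l).
  by exists e => l; apply: He; rewrite mem_enum.
elim: (enum I) => [|l s [e He]]; first by exists 0%N.
have [e' He'] := H l; exists (maxn e e') => l'; rewrite inE -mulrA => /orP[/eqP ->|l's].
  by apply: inspan_exp (leq_maxr _ _) _; rewrite mulrA.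
by apply: inspan_exp (leq_maxl _ _) _; rewrite mulrA; apply: He.
Qed.

Lemma finmul_scalar f c : finmul f (rho c).
Proof. by exists 0%N => l; rewrite mul1r; apply/inspanM/inspan_base. Qed.

Lemma finmulD f p p' : finmul f p -> finmul f p' -> finmul f (p + p').
Proof.
move=> [e He] [e' He']; apply: finmul_pointwise => l; exists (maxn e e').
rewrite mulrDr mulrDl; apply: inspanD; rewrite -mulrA.
  by apply: inspan_exp (leq_maxl _ _) _; rewrite mulrA.
by apply: inspan_exp (leq_maxr _ _) _; rewrite mulrA.
Qed.

Lemma finmul_inspan f p a : finmul f p -> inspan a ->
  exists e, inspan (rho f ^+ e * p * a).
Proof.
move=> [e He] [Q ->]; exists e; rewrite mulr_sumr; apply: inspan_sum => l _.
by rewrite mulrCA; apply: inspanM.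
Qed.

Lemma finmulM f p p' : finmul f p -> finmul f p' -> finmul f (p * p').
Proof.
move=> Hp [e' He']; apply: finmul_pointwise => l.
have [e He] := finmul_inspan Hp (He' l); exists (e + e')%N.
by rewrite (_ : _ * w l = rho f ^+ e * p * (rho f ^+ e' * p' * w l)) // exprD; ring.
Qed.

Lemma finmulX f p n : finmul f p -> finmul f (p ^+ n).
Proof.
move=> Hp; elim: n => [|n IH]; last by rewrite exprS; apply: finmulM.
by rewrite expr0 -(rmorph1 rho); apply: finmul_scalar.
Qed.
End FiniteUpTo.

(** * Relative Noether normalization *)

Section Noether.
Variables (S A : idomainType) (s : {rmorphism S -> A}).
Hypothesis s_inj : injective s.

Definition alg_free k (z : 'I_k -> A) :=
  forall P : {mpoly S[k]}, mmap s z P = 0 -> P = 0.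

Lemma finmul_mmap k (z : 'I_k -> A) (R : comNzRingType) (rho : {rmorphism R -> A})
    (I : finType) (w : I -> A) f (iota : S -> R) (P : {mpoly S[k]}) :
  (forall c, rho (iota c) = s c) -> (forall j, finmul rho w f (z j)) ->
  finmul rho w f (mmap s z P).
Proof.
move=> iotaE Hz; elim/mpoly_ring_ind: P => [c|i|p q Hp Hq|p q Hp Hq].
- by rewrite mmapC /= -iotaE; apply: finmul_scalar.
- by rewrite mmapX mmap1U.
- by rewrite rmorphD; apply: finmulD.
- by rewrite rmorphM; apply: finmulM.
Qed.

(* Nagata's change of variables z_i - z_0^(D^i) makes z_0 integral, up to the
   leading coefficient of the relation, over the other new variables. *)
Lemma nagata k (z : 'I_k.+1 -> A) : ~ alg_free z ->
  exists D (z' : 'I_k -> A), (forall j, z (lift ord0 j) = z' j + z ord0 ^+ (D ^ j.+1)%N) /\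
  exists c e (Q : nat -> {mpoly S[k]}), c != 0 /\
    s c * z ord0 ^+ e = \sum_(i < e) mmap s z' (Q i) * z ord0 ^+ i.
Proof.
move=> nfree; have [P nP] := not_all_ex_not _ _ nfree.
have [Pz /eqP P0] := imply_to_and _ _ nP.
have [D PD] := expo_bound P; exists D.
pose z' (j : 'I_k) := z (lift ord0 j) - z ord0 ^+ (D ^ j.+1)%N; exists z'.
split=> [j|]; first by rewrite /z' subrK.
(* [G] below is [P] rewritten as a univariate polynomial in [z_0] with coefficients in the new
   variables; index 0 is sent to the univariate variable itself. *)
pose h (i : 'I_k.+1) : {poly {mpoly S[k]}} :=
  if unlift ord0 i is Some j then ('X_j)%:P + 'X^(D ^ j.+1) else 'X.
have D0 : (0 < D)%N.
  case E: (msupp P) => [|m t]; first by move: P0; rewrite -msupp_eq0 E.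
  by apply: leq_trans (PD m _ ord0) => //; rewrite E mem_head.
have hs i : size (h i) = (D ^ i).+1.
  rewrite /h; case: unliftP => [j ->|->]; last by rewrite size_polyX expn0.
  rewrite addrC size_polyDl size_polyXn //; apply: leq_ltn_trans (size_polyC_leq1 _) _.
  by rewrite ltnS expn_gt0 D0.
have hm i : h i \is monic.
  rewrite /h; case: unliftP => [j _|_]; last exact: monicX.
  rewrite monicE addrC lead_coefDl ?lead_coefXn // size_polyXn.
  by apply: leq_ltn_trans (size_polyC_leq1 _) _; rewrite ltnS expn_gt0 D0.
have [m0 m0P []] := kronecker_lead (@mpolyC k S) hm hs P0 PD.
set G := mmap _ _ _ => Glead Gsize; set e := kwt D m0 in Glead Gsize.
pose th : {rmorphism {mpoly S[k]} -> A} := mmap s z'.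
have GP : (map_poly th G).[z ord0] = 0.
  rewrite -Pz /G.
  pose f1 : {rmorphism {mpoly S[k.+1]} -> A} :=
    horner_eval (z ord0) \o (map_poly th \o mmap (polyC \o @mpolyC k S) h).
  pose f2 : {rmorphism {mpoly S[k.+1]} -> A} := mmap s z.
  apply: (@rmorph_mpoly_eq _ _ _ f1 f2) => [c|i] /=.
    by rewrite !mmapC /= map_polyC /horner_eval hornerC /= mmapC.
  rewrite !mmapX !mmap1U /h /horner_eval /=; case: unliftP => [j ->|->].
    rewrite rmorphD /= map_polyC map_polyXn /= !hornerE /th /= mmapX mmap1U /z'.
    by rewrite subrK.
  by rewrite map_polyX hornerX.
(* The leading coefficient of [G] is a scalar of [S], namely the coefficient of [P] at the heaviest
   monomial; the lower terms change side, hence the sign. *)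
exists P@_m0, e, (fun i => - G`_i); split; first by rewrite -mcoeff_msupp.
move: GP; rewrite (@horner_coef_wide _ e.+1); last first.
  exact: leq_trans (size_poly _ _) _.
rewrite big_ord_recr /= coef_map Glead /= mmapC => /eqP.
rewrite addr_eq0 => /eqP/(congr1 -%R); rewrite opprK => <-.
by rewrite -sumrN; apply: eq_bigr => i _; rewrite coef_map /= mmapN mulNr.
Qed.

(** Induction on [k]: a dependent family loses [z_0] by [nagata], and [z_0] is then integral over
    the others up to a scalar. Only scalars of [S] are ever inverted, whence the form [c%:MP] of the
    denominator. The element 1 is kept among the [w] for the determinant and counting arguments. *)
Lemma noether_normalization k (z : 'I_k -> A) :
  exists r (y : 'I_r -> A) c (I : finType) (w : I -> A),
    [/\ alg_free y, c != 0, exists l, w l = 1 &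
        forall j, finmul (mmap s y) w c%:MP (z j)].
Proof.
elim: k z => [|k IH] z; have [zfree|znfree] := classic (alg_free z).
- by exists 0%N, z, 1, unit, (fun=> 1); split=> //; [exact: oner_neq0|case].
- case: znfree => P; rewrite [P]nvar0_mpolyC mmapC => /eqP.
  by rewrite -(rmorph0 s) (inj_eq s_inj) => /eqP ->; rewrite mpolyC0.
- exists k.+1, z, 1, unit, (fun=> 1); split=> //; first exact: oner_neq0.
  move=> j; rewrite -[z j](mmap1U z) -(mmapX z s); exact: finmul_scalar.
have [D [z' [zE [c2 [e [Q [c20 Qrel]]]]]]] := nagata znfree.
have [r [y [c1 [I [w [yfree c10 [l1 wl1] Hw]]]]]] := IH z'.
have e0 : (0 < e)%N.
  rewrite lt0n; apply: contra_neq c20 => e0; apply: s_inj.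
  by move: Qrel; rewrite e0 big_ord0 mulr1 rmorph0.
(* Products with the powers of [z_0] below the degree [e] of its integral relation. *)
pose W (x : I * 'I_e) := w x.1 * z ord0 ^+ x.2.
exists r, y, (c1 * c2), (I * 'I_e)%type, W; split=> //; first exact: mulf_neq0.
  by exists (l1, Ordinal e0); rewrite /W /= wl1 mulr1.
pose rho : {rmorphism {mpoly S[r]} -> A} := mmap s y.
have span_up (i : 'I_e) a : inspan rho w a -> inspan rho W (a * z ord0 ^+ i).
  move=> [P ->]; rewrite mulr_suml; apply: inspan_sum => l _.
  by rewrite -mulrA; apply: inspanM; apply: (inspan_base rho W (l, i)).
have rhoC c : rho c%:MP = s c by rewrite /rho /= mmapC.
have rhoE : rho (c1 * c2)%:MP = rho c1%:MP * s c2.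
  by rewrite mpolyCM rmorphM /= [X in _ * X]mmapC.
have fin_up p : finmul rho w c1%:MP p -> finmul rho W (c1 * c2)%:MP p.
  move=> [N HN]; exists N => -[l i]; have /(inspanM (c2%:MP ^+ N)) := span_up i _ (HN l).
  rewrite rmorphXn /= mmapC rhoE exprMn /W /=.
  by congr inspan; ring.
have fin0 : finmul rho W (c1 * c2)%:MP (z ord0).
  apply: finmul_pointwise => -[l i]; have [lt_ie|ge_ie] := ltnP i.+1 e.
    exists 0%N; rewrite mul1r /W /= mulrCA -exprS.
    exact: (inspan_base rho W (l, Ordinal lt_ie)).
  (* At the top power the relation turns [c2 * z_0 ^ e] into lower powers; a common power of [c1]
     then brings every [Q j] times [w l] back into the span of [w]. *)
  have ie : i.+1 = e by apply/eqP; rewrite eqn_leq ge_ie ltn_ord.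
  have [N HN] : exists N, forall j : 'I_e,
      inspan rho w (rho c1%:MP ^+ N * mmap s z' (Q j) * w l).
    suff [N HN] : exists N, forall j, j \in enum 'I_e ->
        inspan rho w (rho c1%:MP ^+ N * mmap s z' (Q j) * w l).
      by exists N => j; apply: HN; rewrite mem_enum.
    elim: (enum 'I_e) => [|j t [N HN]]; first by exists 0%N.
    have [N' HN'] : finmul rho w c1%:MP (mmap s z' (Q j)).
      apply: (@finmul_mmap _ _ _ _ _ _ _ (@mpolyC _ _)) => //.
    exists (maxn N N') => j'; rewrite inE -mulrA => /orP[/eqP ->|j't].
      by apply: inspan_exp (leq_maxr _ _) _; rewrite mulrA; apply: HN'.
    by apply: inspan_exp (leq_maxl _ _) _; rewrite mulrA; apply: HN.
  exists N.+1; rewrite /W /=.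
  have -> : rho (c1 * c2)%:MP ^+ N.+1 * z ord0 * (w l * z ord0 ^+ i) =
     rho ((c1%:MP) * c2%:MP ^+ N) *
     (\sum_(j < e) (rho c1%:MP ^+ N * mmap s z' (Q j) * w l) * z ord0 ^+ j).
    rewrite (eq_bigr (fun j : 'I_e =>
      (rho c1%:MP ^+ N * w l) * (mmap s z' (Q j) * z ord0 ^+ j))); last by move=> j _; ring.
    have zei : z ord0 ^+ e = z ord0 * z ord0 ^+ i by rewrite -exprS ie.
    rewrite -mulr_sumr -Qrel zei rhoE rmorphM rmorphXn.
    rewrite (rhoC c1) (rhoC c2) exprMn !exprS; ring.
  apply: inspanM; apply: inspan_sum => j _; exact: span_up.
move=> j; case: (unliftP ord0 j) => [i ->|-> //]; rewrite zE.
by apply: finmulD; [apply: fin_up|apply: finmulX].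
Qed.
End Noether.

(** * Ideals and lying over *)

Section Ideals.
Variable A : comNzRingType.

Definition ideal_pred (J : A -> Prop) :=
  [/\ J 0, forall a b, J a -> J b -> J (a + b) & forall c a, J a -> J (c * a)].

Lemma ideal_sum (J : A -> Prop) (T : Type) (s : seq T) (P : pred T) (a : T -> A) :
  ideal_pred J -> (forall i, P i -> J (a i)) -> J (\sum_(i <- s | P i) a i).
Proof. by case=> J0 JD _ Ja; apply: big_ind. Qed.

Lemma idealB (J : A -> Prop) a b : ideal_pred J -> J a -> J b -> J (a - b).
Proof. by case=> _ JD JM Ja Jb; apply: JD => //; rewrite -mulN1r; apply: JM. Qed.

Lemma idealBr (J : A -> Prop) a b : ideal_pred J -> J (a - b) -> J b -> J a.
Proof. by move=> [_ JD _] Jab Jb; rewrite -(subrK b a); apply: JD. Qed.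

Definition adjoin (J : A -> Prop) (p a : A) := exists b, J (a - b * p).

Lemma adjoin_ideal J p : ideal_pred J -> ideal_pred (adjoin J p).
Proof.
move=> [J0 JD JM]; split; first by exists 0; rewrite mul0r subr0.
  move=> a b [a' Ja] [b' Jb]; exists (a' + b').
  by rewrite mulrDl opprD addrACA; apply: JD.
by move=> c a [b Jb]; exists (c * b); rewrite -mulrA -mulrBr; apply: JM.
Qed.

Lemma adjoin_sub (J : A -> Prop) p a : J a -> adjoin J p a.
Proof. by exists 0; rewrite mul0r subr0. Qed.

(** Applying the adjugate to the system puts every product of the determinant with a [w l] in [J];
    the entry [l1], where [w] is 1, is the determinant itself. *)
Lemma det_trick (J : A -> Prop) (I : finType) (w : I -> A) (B : I -> I -> A) l1 :
  ideal_pred J -> w l1 = 1 -> (forall k, J (\sum_l B k l * w l)) ->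
  J (\det (\matrix_(i < #|I|, j < #|I|) B (enum_val i) (enum_val j))).
Proof.
move=> idJ wl1 JB; set M := \matrix_(i, j) _.
pose v := \col_(i < #|I|) w (enum_val i).
have Jv : J ((\adj M *m (M *m v)) (enum_rank l1) 0).
  rewrite mxE; apply: ideal_sum => // k _; case: idJ => _ _ JM; apply: JM.
  rewrite mxE (reindex enum_rank) /=; last first.
    by exists enum_val => x _; rewrite ?enum_valK ?enum_rankK.
  under eq_bigr => l _ do rewrite !mxE !enum_rankK.
  exact: JB.
by move: Jv; rewrite mulmxA mul_adj_mx mul_scalar_mx !mxE enum_rankK wl1 mulr1.
Qed.
End Ideals.

Section Nullstellensatz.
Variable F : numClosedFieldType.

(** [g] splits into linear factors. If every [p - c z] were invertible modulo [J], so would be their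
    product, the value of [g] at [p], which lies in the proper ideal [J]. *)
Lemma ideal_split (A : comNzRingType) (c : {rmorphism F -> A}) (J : A -> Prop) p (g : {poly F}) :
  ideal_pred J -> ~ J 1 -> g \is monic -> J (map_poly c g).[p] ->
  exists z, ~ adjoin J (p - c z) 1.
Proof.
move=> idJ nJ1 gm; have [s ->] := closed_field_poly_normal g.
rewrite (monicP gm) scale1r => Jg; apply: NNPP => noz; apply: nJ1.
have allz z : adjoin J (p - c z) 1 by apply: NNPP => h; apply: noz; exists z.
have [_ _ JM] := idJ.
suff [b Jb] : exists b, J (1 - b * (map_poly c (\prod_(z <- s) ('X - z%:P))).[p]).
  by apply: idealBr Jb _ => //; apply: JM.
elim: s {gm Jg} => [|z s [b Jb]].
  by exists 1; rewrite big_nil rmorph1 hornerC mulr1 subrr; case: idJ.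
have [b' Jb'] := allz z; exists (b * b'); rewrite big_cons rmorphM hornerM /=.
rewrite rmorphB /= map_polyX map_polyC /= hornerXsubC.
set P := (map_poly _ _).[p] in Jb *; set l := p - c z in Jb' *.
rewrite (_ : 1 - b * b' * (l * P) = (1 - b * P) + (b * P) * (1 - b' * l)); last by ring.
by case: idJ => _ JD _; apply: JD => //; apply: JM.
Qed.

(** A Nullstellensatz made elementary by integrality: [ideal_split] fixes one coordinate at a time
    and keeps the ideal proper. The final ideal contains every [a - a(z)], so an [a] of [J] with
    [a(z)] nonzero would put 1 in it. *)
Lemma ideal_point n (J : {mpoly F[n]} -> Prop) :
  ideal_pred J -> ~ J 1 ->
  (forall i, exists2 g : {poly F}, g \is monic & J (map_poly (@mpolyC n F) g).['X_i]) ->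
  exists z : 'I_n -> F, forall a, J a -> a.@[z] = 0.
Proof.
move=> idJ nJ1 Jint.
suff [J' [z [idJ' nJ'1 JJ' J'z]]] : exists J' (z : 'I_n -> F),
    [/\ ideal_pred J', ~ J' 1, forall a, J a -> J' a &
        forall i, i \in enum 'I_n -> J' ('X_i - (z i)%:MP)].
  have J'P a : J' (a - (a.@[z])%:MP).
    case: (idJ') => J'0 J'D J'M.
    elim/mpoly_ring_ind: a => [c|i|p q Hp Hq|p q Hp Hq].
    - by rewrite mevalC subrr.
    - by rewrite mevalXU; apply: J'z; rewrite mem_enum.
    - by rewrite mevalD mpolyCD opprD addrACA; apply: J'D.
    - rewrite mevalM mpolyCM (_ : _ - _ = q * (p - p.@[z]%:MP) +
        p.@[z]%:MP * (q - q.@[z]%:MP)); last by ring.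
      by apply: J'D; apply: J'M.
  exists z => a /JJ' J'a; apply: NNPP => /eqP az; apply: nJ'1.
  have := idealB idJ' J'a (J'P a); rewrite opprB addrC subrK.
  case: (idJ') => _ _ J'M /(J'M (a.@[z]^-1)%:MP).
  by rewrite -mpolyCM mulVf // mpolyC1.
elim: (enum 'I_n) => [|i s [J' [z [idJ' nJ'1 JJ' J'z]]]]; first by exists J, (fun=> 0).
have [g gm /JJ' Jg] := Jint i; have [t nt] := ideal_split idJ' nJ'1 gm Jg.
exists (adjoin J' ('X_i - t%:MP)), (fun j => if j == i then t else z j); split=> //.
- exact: adjoin_ideal.
- by move=> a /JJ' /adjoin_sub; apply.
move=> j; rewrite inE; case: eqP => [-> _|_ /= /J'z]; last exact: adjoin_sub.
by exists 1; rewrite mul1r subrr; case: idJ'.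
Qed.

Section LyingOver.
Variables (n : nat) (R : comNzRingType) (rho : {rmorphism R -> {mpoly F[n]}}).
Variables (ev : {rmorphism R -> F}) (iota : F -> R).
Hypotheses (rho_iota : forall c, rho (iota c) = c%:MP) (ev_iota : forall c, ev (iota c) = c).
Variables (I : finType) (w : I -> {mpoly F[n]}) (l1 : I) (f : R).
Hypotheses (wl1 : w l1 = 1) (fin : forall p, finmul rho w f p) (ev_f : ev f != 0).
Variable J : {mpoly F[n]} -> Prop.
Hypotheses (idJ : ideal_pred J) (Jev : forall a, J (rho a) -> ev a = 0).

Let sp a := exists2 c : I -> R, forall l, ev (c l) = 0 & J (a - \sum_l rho (c l) * w l).
(* J' is J + rho(ker ev) A, with f inverted. *)
Let J' a := forall k, exists N, sp (rho f ^+ N * a * w k).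

Let spD a b : sp a -> sp b -> sp (a + b).
Proof.
move=> [c ec Jc] [d ed Jd]; exists (fun l => c l + d l) => [l|].
  by rewrite rmorphD ec ed addr0.
under eq_bigr => l _ do rewrite rmorphD mulrDl.
by rewrite big_split opprD addrACA; case: idJ => _ JD _; apply: JD.
Qed.

Let sp_up c a : sp a -> sp (rho c * a).
Proof.
move=> [d ed Jd]; exists (fun l => c * d l) => [l|]; first by rewrite rmorphM ed mulr0.
under eq_bigr => l _ do rewrite rmorphM -mulrA.
by rewrite -mulr_sumr -mulrBr; case: idJ => _ _; apply.
Qed.

Let sp_exp N N' a : (N <= N')%N -> sp (rho f ^+ N * a) -> sp (rho f ^+ N' * a).
Proof. by move=> le H; rewrite -(subnK le) exprD -mulrA -rmorphXn; apply: sp_up. Qed.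

Let sp_sum (T : Type) (s : seq T) (P : pred T) (a : T -> {mpoly F[n]}) :
  (forall i, P i -> sp (a i)) -> sp (\sum_(i <- s | P i) a i).
Proof.
move=> spa; apply: big_ind => //; exists (fun=> 0) => [l|]; first exact: rmorph0.
rewrite big1 ?subr0 => [|l _]; last by rewrite rmorph0 mul0r.
by case: idJ.
Qed.

Let J'_uniform a : J' a -> exists N, forall k, sp (rho f ^+ N * a * w k).
Proof.
move=> /fin_all_exists[N HN]; exists (\max_k N k)%N => k.
by rewrite -mulrA; apply: sp_exp (leq_bigmax k) _; rewrite mulrA.
Qed.

Let J'_ideal : ideal_pred J'.
Proof.
split.
- move=> k; exists 0%N; rewrite mulr0 mul0r; exists (fun=> 0) => [l|]; first exact: rmorph0.
  rewrite big1 ?subr0 => [|l _]; last by rewrite rmorph0 mul0r.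
  by case: idJ.
- move=> a b J'a J'b k; have [N HN] := J'a k; have [N' HN'] := J'b k.
  exists (maxn N N'); rewrite mulrDr mulrDl; apply: spD; rewrite -mulrA.
    by apply: sp_exp (leq_maxl _ _) _; rewrite mulrA.
  by apply: sp_exp (leq_maxr _ _) _; rewrite mulrA.
- move=> p a /J'_uniform[N HN] k; have [e /(_ k)[Q HQ]] := fin p; exists (N + e)%N.
  rewrite exprD (_ : _ * w k = rho f ^+ N * a * (rho f ^+ e * p * w k)); last by ring.
  rewrite HQ mulr_sumr; apply: sp_sum => l _.
  by rewrite mulrCA; apply: sp_up.
Qed.

Let J'_J a : J a -> J' a.
Proof.
move=> Ja k; exists 0%N; exists (fun=> 0) => [l|]; first exact: rmorph0.
rewrite big1 ?subr0 => [|l _]; last by rewrite rmorph0 mul0r.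
by case: idJ => _ _ JM; rewrite mul1r mulrC; apply: JM.
Qed.

Let J'_ev a : ev a = 0 -> J' (rho a).
Proof.
move=> ea k; exists 0%N; rewrite mul1r; exists (fun l => a * (l == k)%:R) => [l|].
  by rewrite rmorphM ea mul0r.
rewrite (bigD1 k) //= eqxx mulr1 big1 => [|l /negPf ->]; last by rewrite mulr0 rmorph0 mul0r.
by rewrite addr0 subrr; case: idJ.
Qed.

(** Nakayama: if 1 were in [J'], the matrix [f ^ N - c] with [c] in the kernel of [ev] would send
    [w] into [J]. Its determinant comes from [R], so [Jev] makes its value under [ev] zero, yet that
    value is a power of [ev f]. *)
Let J'_proper : ~ J' 1.
Proof.
move=> /J'_uniform[N /fin_all_exists2[c ec Jc]].
pose B0 k l := f ^+ N * (k == l)%:R - c k l.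
have JB k : J (\sum_l rho (B0 k l) * w l).
  under eq_bigr => l _ do rewrite /B0 rmorphB mulrBl.
  rewrite sumrB (bigD1 k) //= eqxx mulr1 big1 => [|l kl]; last first.
    by rewrite eq_sym (negPf kl) mulr0 rmorph0 mul0r.
  by have := Jc k; rewrite mulr1 addr0 rmorphXn.
have := det_trick idJ wl1 JB.
rewrite (_ : \matrix_(i, j) _ = map_mx rho
   (\matrix_(i < #|I|, j < #|I|) B0 (enum_val i) (enum_val j))); last first.
  by apply/matrixP => i j; rewrite !mxE.
rewrite det_map_mx => /Jev; rewrite -det_map_mx.
rewrite (_ : map_mx _ _ = (ev f ^+ N)%:M).
  by rewrite det_scalar => /eqP; rewrite !expf_eq0 (negPf ev_f) !andbF.
apply/matrixP => i j; rewrite !mxE rmorphB rmorphM rmorphXn /= ec subr0.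
by rewrite (inj_eq enum_val_inj) rmorph_nat mulr_natr.
Qed.

Let J'_const a : J' (rho a - (ev a)%:MP).
Proof. by rewrite -rho_iota -rmorphB; apply: J'_ev; rewrite rmorphB ev_iota subrr. Qed.

(** Modulo [J'] the ring [R] acts through [ev], so [p] acts on [w] by a matrix over the field [F],
    and its characteristic polynomial is the monic relation. *)
Let J'_integral p :
  exists2 g : {poly F}, g \is monic & J' (map_poly (@mpolyC n F) g).[p].
Proof.
have [N /fin_all_exists[Q HQ]] := fin p.
pose L := \matrix_(i < #|I|, j < #|I|) (ev (Q (enum_val i) (enum_val j)) / ev f ^+ N).
exists (char_poly L); first exact: char_poly_monic.
pose B k l := p * (k == l)%:R - (ev (Q k l) / ev f ^+ N)%:MP.
have JB k : J' (\sum_l B k l * w l).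
  under eq_bigr => l _ do rewrite mulrBl.
  rewrite sumrB (bigD1 k) //= eqxx mulr1 big1 ?addr0 => [|l kl]; last first.
    by rewrite eq_sym (negPf kl) mulr0 mul0r.
  have efN : ev f ^+ N != 0 by rewrite expf_neq0.
  case: (J'_ideal) => _ J'D J'M.
  have -> : p * w k - \sum_l (ev (Q k l) / ev f ^+ N)%:MP * w l =
     ((ev f ^+ N)^-1)%:MP * (((ev (f ^+ N))%:MP - rho (f ^+ N)) * (p * w k) +
       \sum_l (rho (Q k l) - (ev (Q k l))%:MP) * w l).
    under [X in _ * (_ + X)]eq_bigr => l _ do rewrite mulrBl.
    rewrite sumrB -HQ rmorphXn /= rmorphXn /=.
    rewrite [X in _ = _ * X](_ : _ = (ev f ^+ N)%:MP * (p * w k) -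
      \sum_l (ev (Q k l))%:MP * w l); last by rewrite mulrBl !mulrA addrA subrK.
    rewrite mulrBr mulrA -mpolyCM mulVf // mpolyC1 mul1r mulr_sumr.
    by congr (_ - _); apply: eq_bigr => l _; rewrite mulrA -mpolyCM mulrC [_ / _]mulrC mulrC.
  apply: (J'M); apply: J'D.
    by rewrite mulrC -opprB mulrN -mulNr; apply: (J'M); apply: J'_const.
  by apply: ideal_sum => // l _; rewrite mulrC; apply: J'M; apply: J'_const.
have := det_trick J'_ideal wl1 JB.
congr J'; rewrite /char_poly -horner_evalE -det_map_mx -det_map_mx; congr (\det _).
apply/matrixP => i j; rewrite !mxE /B (inj_eq enum_val_inj).
rewrite mulr_natr rmorphB rmorphMn /= map_polyX map_polyC /horner_eval.
by rewrite hornerD hornerN hornerMn hornerX hornerC.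
Qed.

(** [Jev] says that [J] meets [R] inside the kernel of [ev]. [J'] adds that kernel to [J], stays
    proper and makes all coordinates integral, so it has a zero; since it contains [rho a - ev a],
    this zero lies over [ev]. *)
Lemma lying_over : exists z : 'I_n -> F,
  (forall a, J a -> a.@[z] = 0) /\ (forall a, (rho a).@[z] = ev a).
Proof.
have [z Hz] := ideal_point J'_ideal J'_proper (fun i => J'_integral 'X_i).
exists z; split=> [a /J'_J|a]; first exact: Hz.
by apply/eqP; rewrite -subr_eq0 -[ev a](mevalC z) -mevalB; apply/eqP/Hz.
Qed.
End LyingOver.
End Nullstellensatz.

(** * Counting monomials *)

Lemma card_bmultinom t B : (#|{: 'X_{1..t < B.+1}}| <= B.+1 ^ t)%N.
Proof.
have -> : (B.+1 ^ t = #|{ffun 'I_t -> 'I_B.+1}|)%N by rewrite card_ffun !card_ord.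
pose h (m : 'X_{1..t < B.+1}) : {ffun 'I_t -> 'I_B.+1} := [ffun i => inord ((m : 'X_{1..t}) i)].
apply: (@leq_card _ _ h) => m m' /ffunP hm; apply/val_inj/mnmP => i /=.
have lt (m0 : 'X_{1..t < B.+1}) : ((m0 : 'X_{1..t}) i < B.+1)%N.
  by apply: leq_ltn_trans (bmdeg m0); rewrite mdegE (bigD1 i) //= leq_addr.
by have := congr1 val (hm i); rewrite !ffunE /= !inordK.
Qed.

Lemma wide_kernel (F : fieldType) r c (L : 'M[F]_(r, c)) :
  (c < r)%N -> exists2 v : 'rV_r, v != 0 & v *m L = 0.
Proof.
move=> lt_cr; have : kermx L != 0.
  by rewrite -mxrank_eq0 mxrank_ker -lt0n subn_gt0; apply: leq_ltn_trans (rank_leq_col L) _.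
by case/rowV0Pn => v /sub_kermxP vL v0; exists v.
Qed.

Section Counting.
Variables (F : fieldType) (X : Type) (t : nat) (u : X -> 'I_t -> F).
Variables (I : finType) (w : X -> I -> F) (l1 : I) (f : {mpoly F[t]}).
Variables (k : nat) (g : X -> 'I_k -> F) (Q : 'I_k -> I -> I -> {mpoly F[t]}).
Hypothesis wl1 : forall x, w x l1 = 1.
Hypothesis fg : forall x j l,
  f.@[u x] * g x j * w x l = \sum_l' (Q j l l').@[u x] * w x l'.

Let D := (maxn (msize f) (\max_j \max_l \max_l' msize (Q j l l')))%N.

(** As [msize] is the degree plus one, coefficients of degree up to [D * e] are allowed: the bound
    grows only linearly with the number [e] of factors [f]. *)
Let small e (a : X -> F) := exists q : I -> {mpoly F[t]},
  (forall l, msize (q l) <= (D * e).+1)%N /\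
  forall x, a x = \sum_l (q l).@[u x] * w x l.

Let smallM e (p q : {mpoly F[t]}) : (msize p <= D)%N -> (msize q <= (D * e).+1)%N ->
  (msize (p * q) <= (D * e.+1).+1)%N.
Proof.
move=> pD qD; have [->|p0] := eqVneq p 0; first by rewrite mul0r msize0.
have [->|q0] := eqVneq q 0; first by rewrite mulr0 msize0.
rewrite msizeM // mulnS; move: pD qD; move: (D * e)%N D (mmeasure _ p) (mmeasure _ q).
by move=> x y a b; lia.
Qed.

Let small_step j e a : small e a -> small e.+1 (fun x => f.@[u x] * g x j * a x).
Proof.
move=> [q [qD qE]]; exists (fun l' => \sum_l Q j l l' * q l); split=> [l'|x].
  apply: leq_trans (msize_sum _ _ _) _; apply/bigmax_leqP => l _.
  apply: smallM => //; rewrite /D leq_max; apply/orP; right.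
  apply: leq_trans (leq_bigmax j); apply: leq_trans (leq_bigmax l).
  exact: (leq_bigmax l').
rewrite qE mulr_sumr.
under eq_bigr => l _ do rewrite mulrCA fg mulr_sumr.
rewrite exchange_big /=; apply: eq_bigr => l' _.
rewrite raddf_sum /= mulr_suml; apply: eq_bigr => l _.
by rewrite mevalM mulrCA mulrA.
Qed.

Let small_pad e a : small e a -> small e.+1 (fun x => f.@[u x] * a x).
Proof.
move=> [q [qD qE]]; exists (fun l => f * q l); split=> [l|x].
  by apply: smallM => //; rewrite /D leq_max leqnn.
rewrite qE mulr_sumr; apply: eq_bigr => l _.
by rewrite mevalM mulrA.
Qed.

Let small_mon e (m : 'X_{1..k}) : (mdeg m <= e)%N ->
  small e (fun x => f.@[u x] ^+ e * ('X_[m]).@[g x]).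
Proof.
have small_ext e' a b : a =1 b -> small e' a -> small e' b.
  by move=> ab [q [qD qE]]; exists q; split=> // x; rewrite -ab.
elim: e m => [|e IH] m me.
  have -> : m = 0%MM by apply/eqP; rewrite -mdeg_eq0 -leqn0.
  exists (fun l => (l == l1)%:R); split=> [l|x].
    by case: eqP => _; rewrite ?msize1 ?msize0.
  rewrite mpolyX0 meval1 expr0 mulr1 (bigD1 l1) //= eqxx meval1 mul1r wl1.
  by rewrite big1 ?addr0 // => l /negPf ->; rewrite meval0 mul0r.
have [m0|m0] := posnP (mdeg m).
  apply: small_ext (small_pad (IH m _)) => [x|]; last by rewrite m0.
  by rewrite mulrA exprS.
have [i mi] : exists i, (0 < m i)%N.
  apply: NNPP => h; move: m0; rewrite mdegE big1 // => i _.
  by apply/eqP; rewrite -leqn0 leqNgt; apply/negP => mi; apply: h; exists i.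
have mE : m = (U_(i) + (m - U_(i)))%MM by rewrite addmC submK // lep1mP -lt0n.
apply: small_ext (small_step i (IH (m - U_(i))%MM _)) => [x|]; last first.
  by move: me; rewrite {1}mE mdegD mdeg1.
by rewrite [in RHS]mE mpolyXD mevalM mevalXU exprS; ring.
Qed.

(** Times [f ^ N] with [N = k * b], each of the [b ^ k] monomials in [g] with exponents below [b] is
    a combination of the [w] with coefficients of degree at most [D * N] in [t] variables. This
    leaves at most [#|I| * (D * k + 1) ^ t * b ^ t] coefficient places, and [b] is chosen so that
    this is less than [b ^ t.+1], hence than [b ^ k]. The points range over any type [X], so that
    the count serves both affine space and a fiber. *)
Lemma alg_dependent : (t < k)%N ->
  exists2 P : {mpoly F[k]}, P != 0 &
    exists N, forall x, f.@[u x] ^+ N * P.@[g x] = 0.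
Proof.
move=> tk; pose b := (#|I| * (D * k).+1 ^ t).+1; pose N := (k * b)%N.
pose B := (D * N)%N.
pose al (a : {ffun 'I_k -> 'I_b}) : 'X_{1..k} := [multinom (a i : nat) | i < k].
have al_inj : injective al.
  move=> a a' /mnmP eqa; apply/ffunP => i; apply/val_inj.
  by have := eqa i; rewrite !mnmE.
have alN a : (mdeg (al a) <= N)%N.
  rewrite mdegE /N; apply: (@leq_trans (\sum_(i < k) b)).
    by apply: leq_sum => i _; rewrite mnmE ltnW.
  by rewrite sum_nat_const card_ord.
have [q Hq] := fin_all_exists (fun a => small_mon (alN a)).
pose L := \matrix_(i < #|{ffun 'I_k -> 'I_b}|, j < #|{: I * 'X_{1..t < B.+1}}|)
  (q (enum_val i) (enum_val j).1)@_(enum_val j).2.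
have lt_cr : (#|{: I * 'X_{1..t < B.+1}}| < #|{ffun 'I_k -> 'I_b}|)%N.
  rewrite card_ffun !card_ord card_prod; apply: (@leq_trans (b ^ t.+1)); last first.
    by rewrite leq_pexp2l.
  apply: leq_ltn_trans (leq_mul (leqnn _) (card_bmultinom _ _)) _.
  apply: (@leq_ltn_trans (#|I| * ((D * k).+1 * b) ^ t)).
    rewrite leq_mul2l; apply/orP; right; have [t0|t0] := posnP t; first by rewrite t0.
    by rewrite leq_exp2r // mulSn /B /N mulnA -add1n leq_add2r.
  rewrite expnMn mulnA expnS ltn_mul2r expn_gt0 /=; exact: ltnSn.
have [v v0 vL] := wide_kernel L lt_cr.
exists (\sum_i v 0 i *: 'X_[al (enum_val i)]).
  apply: contra_neq v0 => P0.
  apply/rowP => i; have := congr1 (mcoeff (al (enum_val i))) P0.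
  rewrite mxE mcoeff0 raddf_sum (bigD1 i) //= mcoeffZ mcoeffX eqxx mulr1.
  rewrite big1 ?addr0 // => j ji; rewrite mcoeffZ mcoeffX (inj_eq al_inj) (inj_eq enum_val_inj).
  by rewrite (negPf ji) mulr0.
exists N => x; rewrite raddf_sum mulr_sumr /=.
under eq_bigr => i _ do rewrite mevalZ mulrCA (Hq _).2 mulr_sumr.
rewrite exchange_big big1 //= => l _.
under eq_bigr => i _ do rewrite mulrA -mevalZ.
rewrite -mulr_suml -raddf_sum /= (_ : \sum_i _ = 0) ?meval0 ?mul0r //.
apply/mpolyP => m; rewrite mcoeff0 raddf_sum /=.
under eq_bigr => i _ do rewrite mcoeffZ.
have [mB|mB] := ltnP (mdeg m) B.+1; last first.
  rewrite big1 // => i _; rewrite (memN_msupp_eq0 (p := q _ _)) ?mulr0 //.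
  by apply: msize_mdeg_ge; apply: leq_trans ((Hq _).1 _) mB.
have := congr1 (fun M : 'rV_ _ => M 0 (enum_rank (l, BMultinom mB))) vL.
rewrite !mxE => E; rewrite -[RHS]E; apply: eq_bigr => i _.
by rewrite mxE enum_rankK.
Qed.
End Counting.

(** * Generic fibers of polynomial maps *)

Lemma not_forall_imply (T : Type) (P Q : T -> Prop) :
  ~ (forall x, P x -> Q x) -> exists x, P x /\ ~ Q x.
Proof.
move=> nPQ; apply: NNPP => nex; apply: nPQ => x Px; apply: NNPP => nQ.
by apply: nex; exists x.
Qed.

Lemma maximal_ideal_pred (A : comNzRingType) (J0 : A -> Prop) (ok : A -> Prop) :
  ideal_pred J0 -> (forall a, J0 a -> ok a) ->
  exists J, [/\ ideal_pred J, forall a, J0 a -> J a, forall a, J a -> ok a &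
    forall J', ideal_pred J' -> (forall a, J a -> J' a) -> (forall a, J' a -> ok a) ->
      forall a, J' a -> J a].
Proof.
move=> id0 ok0.
pose good (J : A -> Prop) := [/\ ideal_pred J, forall a, J0 a -> J a & forall a, J a -> ok a].
pose P (J : A -> Prop) := (forall a, ~ J a) \/ good J.
have chainP (C : (A -> Prop) -> Prop) : (forall X, C X -> P X) ->
    classical_sets.total_on C classical_sets.subset ->
    P (classical_sets.bigcup C id).
  move=> CP Ctot.
  have [noC|nC] := classic (forall X, C X -> forall a, ~ X a).
    by left=> a [X CX Xa]; apply: noC Xa.
  have [X0 [CX0 nX0]] := not_forall_imply nC.
  have [x0 /NNPP X0x0] := not_all_ex_not _ _ nX0.
  have Cgood X x : C X -> X x -> good X by move=> /CP[nX /nX|].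
  have [[X00 _ _] sub0 _] := Cgood _ _ CX0 X0x0.
  right; split; first split.
  - by exists X0.
  - move=> a a' [X CX Xa] [X' CX' X'a].
    have [[_ XD _] _ _] := Cgood _ _ CX Xa; have [[_ X'D _] _ _] := Cgood _ _ CX' X'a.
    have [XX'|X'X] := Ctot _ _ CX CX'.
      by exists X' => //; apply: (X'D) => //; apply: XX'.
    by exists X => //; apply: (XD) => //; apply: X'X.
  - move=> c a [X CX Xa]; have [[_ _ XM] _ _] := Cgood _ _ CX Xa.
    by exists X => //; apply: XM.
  - by move=> a J0a; exists X0 => //; apply: sub0.
  - by move=> a [X CX Xa]; have [_ _] := Cgood _ _ CX Xa; apply.
have [J [PJ maxJ]] := classical_sets.Zorn_bigcup chainP.
case: PJ => [J_empty|[idJ J0J okJ]].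
  have [] := maxJ J0; last by right; split.
  by split=> [a /J_empty|/(_ 0)] //; case: id0 => J00 _ _ /(_ J00)/J_empty.
exists J; split=> // J' idJ' JJ' ok' a J'a; apply: NNPP => nJa.
have [] := maxJ J'; last by right; split=> // x /J0J /JJ'.
by split=> [x /JJ'|/(_ a J'a)].
Qed.

Section Fiber.
Variables (F : numClosedFieldType) (n m : nat) (phi : 'I_m -> {mpoly F[n]}).

Definition vanish (Z : ('I_n -> F) -> Prop) (p : {mpoly F[n]}) := forall v, Z v -> p.@[v] = 0.

Definition alg_indep_on (Z : ('I_n -> F) -> Prop) k (g : 'I_k -> {mpoly F[n]}) :=
  forall P : {mpoly F[k]}, (forall v, Z v -> P.@[fun i => (g i).@[v]] = 0) -> P = 0.

Definition zclosed Z := forall v, (forall p, vanish Z p -> p.@[v] = 0) -> Z v.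

Definition zprime Z := forall p q, vanish Z (p * q) -> vanish Z p \/ vanish Z q.

Definition fiber (b : 'I_m -> F) (v : 'I_n -> F) := forall i, (phi i).@[v] = b i.

Lemma vanish_ideal Z : ideal_pred (vanish Z).
Proof.
split=> [v _|p q Zp Zq v Zv|p q Zq v Zv]; first exact: meval0.
  by rewrite mevalD Zp ?Zq ?addr0.
by rewrite mevalM Zq ?mulr0.
Qed.

Lemma mpoly_ext0 k (p : {mpoly F[k]}) : (forall v, p.@[v] = 0) -> p = 0.
Proof.
move=> p0; apply/eqP; apply/negPn/negP => /mpoly_nonroot[v].
by rewrite p0 eqxx.
Qed.

(** Join a point where [p] is nonzero to one where [q] is nonzero: on that line both restrict to
    nonzero univariate polynomials, which have a common nonroot. *)
Lemma line_prime (L : ('I_n -> F) -> Prop) :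
  (forall a a' t, L a -> L a' -> L (fun i => a i + t * (a' i - a i))) -> zprime L.
Proof.
move=> Lline p q Lpq; apply: NNPP => /not_or_and[np nq].
have [a [La /eqP pa]] := not_forall_imply np.
have [a' [La' /eqP qa]] := not_forall_imply nq.
pose l i : {poly F} := (a i)%:P + 'X * (a' i - a i)%:P.
have lE r t : (mmap (polyC : F -> _) l r).[t] = r.@[fun i => a i + t * (a' i - a i)].
  pose f1 : {rmorphism {mpoly F[n]} -> F} := horner_eval t \o mmap (polyC : F -> _) l.
  pose f2 : {rmorphism {mpoly F[n]} -> F} := meval (fun i => a i + t * (a' i - a i)).
  apply: (rmorph_mpoly_eq (f := f1) (g := f2)) => [c|i] /=.
    by rewrite mmapC mevalC /horner_eval hornerC.
  by rewrite mmapX mmap1U mevalXU /horner_eval /l !hornerE.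
pose P r := mmap (polyC : F -> _) l r.
have Pp0 : P p != 0.
  apply: contra_neq pa => Pp; have := lE p 0; rewrite -/(P p) Pp horner0 => ->.
  by apply: meval_eq => i; rewrite mul0r addr0.
have Pq0 : P q != 0.
  apply: contra_neq qa => Pp; have := lE q 1; rewrite -/(P q) Pp horner0 => ->.
  by apply: meval_eq => i; rewrite mul1r addrC subrK.
have [t] := poly_nonroot (mulf_neq0 Pp0 Pq0).
by rewrite hornerM !lE -mevalM Lpq ?eqxx //; apply: Lline.
Qed.
End Fiber.

Section DominantFiber.
Variables (F : numClosedFieldType) (n m r : nat).
Variables (phi : 'I_m -> {mpoly F[n]}) (y : 'I_r -> {mpoly F[n]}).

Definition phi_comp : {rmorphism {mpoly F[m]} -> {mpoly F[n]}} := mmap (@mpolyC n F) phi.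

Definition relpoly : {rmorphism {mpoly {mpoly F[m]}[r]} -> {mpoly F[n]}} := mmap phi_comp y.

Definition relev (b : 'I_m -> F) (a : 'I_r -> F) :
  {rmorphism {mpoly {mpoly F[m]}[r]} -> F} := mmap (meval b) a.

Lemma phi_compE P v : (phi_comp P).@[v] = P.@[fun i => (phi i).@[v]].
Proof.
pose f1 : {rmorphism {mpoly F[m]} -> F} := meval v \o phi_comp.
pose f2 : {rmorphism {mpoly F[m]} -> F} := meval (fun i => (phi i).@[v]).
apply: (rmorph_mpoly_eq (f := f1) (g := f2)) => [c|i] /=; rewrite /phi_comp /=.
  by rewrite mmapC !mevalC.
by rewrite mmapX mmap1U mevalXU.
Qed.

Lemma relpolyE Q v : (relpoly Q).@[v] = relev (fun i => (phi i).@[v]) (fun j => (y j).@[v]) Q.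
Proof.
pose f1 : {rmorphism {mpoly {mpoly F[m]}[r]} -> F} := meval v \o relpoly.
pose f2 := relev (fun i => (phi i).@[v]) (fun j => (y j).@[v]).
apply: (rmorph_mpoly_eq (f := f1) (g := f2)) => [c|i] /=; rewrite /relpoly /relev /=.
  by rewrite !mmapC phi_compE.
by rewrite !mmapX !mmap1U.
Qed.

Lemma relev_ext b b' a a' Q : b =1 b' -> a =1 a' -> relev b a Q = relev b' a' Q.
Proof.
move=> bb' aa'; apply: (rmorph_mpoly_eq (f := relev b a) (g := relev b' a')) => [c|i] /=.
  by rewrite /relev /= !mmapC; apply: meval_eq.
by rewrite /relev /= !mmapX !mmap1U.
Qed.

Lemma relevC b a c : relev b a (c%:MP) = c.@[b].
Proof. by rewrite /relev /= mmapC. Qed.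

(** The counting lemma takes polynomials over a field, so the two layers of variables, from the
    target and from [y], are merged; [unflat] goes back. *)
Definition flat : {rmorphism {mpoly {mpoly F[m]}[r]} -> {mpoly F[m + r]}} :=
  mmap (mmap (@mpolyC _ F) (fun i => 'X_(lshift r i)) : {rmorphism {mpoly F[m]} -> _})
    (fun j => 'X_(rshift m j)).

Lemma flatE u Q : (flat Q).@[u] = relev (fun i => u (lshift r i)) (fun j => u (rshift m j)) Q.
Proof.
pose f1 : {rmorphism {mpoly {mpoly F[m]}[r]} -> F} := meval u \o flat.
pose f2 := relev (fun i => u (lshift r i)) (fun j => u (rshift m j)).
apply: (rmorph_mpoly_eq (f := f1) (g := f2)) => [c|i] /=; rewrite /flat /relev /= ?mmapC.
  pose g1 : {rmorphism {mpoly F[m]} -> F} :=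
    meval u \o mmap (@mpolyC _ F) (fun i => 'X_(lshift r i)).
  pose g2 : {rmorphism {mpoly F[m]} -> F} := meval (fun i => u (lshift r i)).
  apply: (rmorph_mpoly_eq (f := g1) (g := g2)) => [d|i] /=.
    by rewrite mmapC !mevalC.
  by rewrite mmapX mmap1U !mevalXU.
by rewrite !mmapX !mmap1U mevalXU.
Qed.

Definition unflat : {rmorphism {mpoly F[m + r]} -> {mpoly {mpoly F[m]}[r]}} :=
  mmap (@mpolyC r {mpoly F[m]} \o @mpolyC m F)
    (fun k => match split k with inl i => ('X_i)%:MP | inr j => 'X_j end).

Definition pair_point (b : 'I_m -> F) (a : 'I_r -> F) (k : 'I_(m + r)) :=
  match split k with inl i => b i | inr j => a j end.

Lemma unflatE b a P : relev b a (unflat P) = P.@[pair_point b a].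
Proof.
pose f1 : {rmorphism {mpoly F[m + r]} -> F} := relev b a \o unflat.
pose f2 : {rmorphism {mpoly F[m + r]} -> F} := meval (pair_point b a).
apply: (rmorph_mpoly_eq (f := f1) (g := f2)) => [c|i] /=; rewrite /unflat /=.
  by rewrite mmapC /= relevC !mevalC.
rewrite mmapX mmap1U mevalXU /pair_point; case: split => [j|j].
  by rewrite relevC mevalXU.
by rewrite /relev /= mmapX mmap1U.
Qed.

Definition relspec b : {mpoly {mpoly F[m]}[r]} -> {mpoly F[r]} :=
  mmap (@mpolyC r F \o meval b) (fun j => 'X_j).

Lemma relspecE b a P : (relspec b P).@[a] = relev b a P.
Proof.
pose f1 : {rmorphism {mpoly {mpoly F[m]}[r]} -> F} :=
  meval a \o mmap (@mpolyC r F \o meval b) (fun j => 'X_j).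
apply: (rmorph_mpoly_eq (f := f1) (g := relev b a)) => [d|i] /=; rewrite /relev /=.
  by rewrite !mmapC mevalC.
by rewrite !mmapX !mmap1U mevalXU.
Qed.

Hypothesis y_free : alg_free phi_comp y.
Variables (c : {mpoly F[m]}) (I : finType) (w : I -> {mpoly F[n]}) (l1 : I).
Hypotheses (c0 : c != 0) (wl1 : w l1 = 1).
Hypothesis phi_inj : injective phi_comp.
Hypothesis fin : forall p, finmul relpoly w c%:MP p.

(** By [y_free] the [phi] and [y] together are algebraically independent. They are polynomials in
    [n] variables, so the count with the trivial family [w = 1] and [f = 1] bounds their number. *)
Lemma dim_le : (m + r <= n)%N.
Proof.
rewrite leqNgt; apply/negP => lt_n.
pose g (v : 'I_n -> F) := pair_point (fun i => (phi i).@[v]) (fun j => (y j).@[v]).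
pose gp k := match split k with inl i => phi i | inr j => y j end.
have [|P P0 [N HP]] := @alg_dependent F ('I_n -> F) n id unit (fun _ _ => 1) tt 1 (m + r) g
  (fun k _ _ => gp k) (fun=> erefl) _ lt_n.
  move=> v k _; rewrite big_const card_unit /= meval1 !mulr1 mul1r addr0.
  by rewrite /g /pair_point /gp; case: split.
move/eqP: P0; apply; apply: mpoly_ext0 => u.
have rP : relpoly (unflat P) = 0.
  by apply: mpoly_ext0 => v; rewrite relpolyE unflatE -[RHS](HP v) meval1 expr1n mul1r.
rewrite -(@meval_eq _ _ (pair_point (fun i => u (lshift r i)) (fun j => u (rshift m j)))).
  by rewrite -unflatE (y_free rP) rmorph0.
by move=> k; rewrite /pair_point; case: splitP => j kj; congr u; apply/val_inj.
Qed.

Lemma fin_unif k (p : 'I_k -> {mpoly F[n]}) : exists N (Q : 'I_k -> I -> I -> _),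
  forall j l, relpoly (c%:MP ^+ N) * p j * w l = \sum_l' relpoly (Q j l l') * w l'.
Proof.
have [N HN] := fin_all_exists (fun j => fin (p j)).
have HM j : forall l, inspan relpoly w (relpoly (c%:MP ^+ (\max_i N i)) * p j * w l).
  move=> l; rewrite rmorphXn -mulrA; apply: inspan_exp (leq_bigmax j) _.
  by rewrite mulrA; apply: HN.
have [Q HQ] := fin_all_exists (fun j => fin_all_exists (HM j)).
by exists (\max_i N i)%N, Q.
Qed.

(** The [n] coordinates are finite over the [m + r] polynomials [phi], [y] once [c] is inverted.
    More than [m + r] of them would be dependent up to a power of [c], which is nonzero because
    [phi_comp] is injective. *)
Lemma dim_ge : (n <= m + r)%N.
Proof.
rewrite leqNgt; apply/negP => lt_n.
have [N [Q HQ]] := fin_unif (fun j : 'I_n => 'X_j).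
pose u (v : 'I_n -> F) := pair_point (fun i => (phi i).@[v]) (fun j => (y j).@[v]).
have uE v P : (flat P).@[u v] = (relpoly P).@[v].
  rewrite flatE relpolyE; apply: relev_ext => i; rewrite /u /pair_point.
    by rewrite -[lshift r i]/(unsplit (inl i)) unsplitK.
  by rewrite -[rshift m i]/(unsplit (inr i)) unsplitK.
have [||P P0 [N' HP]] := @alg_dependent F ('I_n -> F) (m + r) u I
  (fun v l => (w l).@[v]) l1 (flat (c%:MP ^+ N)) n id (fun j l l' => flat (Q j l l')) _ _ lt_n.
- by move=> v; rewrite wl1 meval1.
- move=> v j l; rewrite uE -[v j](mevalXU v) -!mevalM HQ raddf_sum.
  by apply: eq_bigr => l' _; rewrite uE -mevalM.
suff /eqP : relpoly (c%:MP ^+ N) ^+ N' * P = 0.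
  rewrite mulf_eq0 (negPf P0) orbF expf_eq0 => /andP[_].
  rewrite rmorphXn expf_eq0 => /andP[_]; rewrite /relpoly /= mmapC.
  by rewrite -(rmorph0 phi_comp) (inj_eq phi_inj) (negPf c0).
apply: mpoly_ext0 => v; rewrite mevalM rmorphXn /= -uE.
have := HP v; congr (_ * _ = _).
Qed.

Section GoodPoint.
Variable b : 'I_m -> F.
Hypothesis cb : c.@[b] != 0.

(** On the fiber [phi] is constant, so all functions are finite over the polynomials in the [r]
    values [y], with the denominator [c] specialized to the nonzero number [c(b)]. *)
Lemma fiber_indep k (g : 'I_k -> {mpoly F[n]}) :
  alg_indep_on (fiber phi b) g -> (k <= r)%N.
Proof.
move=> ind; rewrite leqNgt; apply/negP => lt_k.
have [N [Q HQ]] := fin_unif g.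
pose X := {v | fiber phi b v}.
have relX (x : X) P : (relpoly P).@[sval x] = (relspec b P).@[fun j => (y j).@[sval x]].
  by rewrite relpolyE relspecE; apply: relev_ext => // i; apply: (svalP x).
have [||P P0 [N' HP]] := @alg_dependent F X r (fun x j => (y j).@[sval x]) I
  (fun x l => (w l).@[sval x]) l1 (relspec b (c%:MP ^+ N)) k (fun x j => (g j).@[sval x])
  (fun j l l' => relspec b (Q j l l')) _ _ lt_k.
- by move=> x; rewrite wl1 meval1.
- move=> x j l; rewrite -relX -!mevalM HQ raddf_sum.
  by apply: eq_bigr => l' _; rewrite -relX -mevalM.
move/eqP: P0; apply; apply: ind => v Xv.
have /eqP := HP (exist _ v Xv); rewrite /= relspecE rmorphXn /= relevC.
by rewrite mulf_eq0 !expf_eq0 (negPf cb) !andbF => /eqP.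
Qed.

Definition lin_sub i (a : 'I_r -> F) := forall j : 'I_r, (i <= j)%N -> a j = 0.

(** Geometrically, the image under [(phi, y)] of the zeros of the ideal [J] contains the whole of
    [{b}] times the [i]-dimensional subspace [L_i]: [below_over] derives this by lying over, and
    [vanish_below] is the converse. *)
Definition below i (J : {mpoly F[n]} -> Prop) :=
  forall Q, J (relpoly Q) -> forall a, lin_sub i a -> relev b a Q = 0.

Definition zeros (J : {mpoly F[n]} -> Prop) v := forall p, J p -> p.@[v] = 0.

Lemma below_over i J a : ideal_pred J -> below i J -> lin_sub i a ->
  exists v, [/\ zeros J v, fiber phi b v & forall j, (y j).@[v] = a j].
Proof.
move=> idJ bJ La.
have [|||v [Jv Ev]] := @lying_over F n _ relpoly (relev b a) (fun d => d%:MP%:MP) _ _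
   I w l1 c%:MP wl1 fin _ J idJ (fun Q JQ => bJ Q JQ a La).
- by move=> d; rewrite /relpoly /= mmapC /phi_comp /= mmapC.
- by move=> d; rewrite relevC mevalC.
- by rewrite relevC.
exists v; split=> // [i'|j].
  have := Ev ('X_i')%:MP; rewrite relevC mevalXU => <-.
  by rewrite /relpoly /= mmapC /phi_comp /= mmapX mmap1U.
have := Ev 'X_j; rewrite /relpoly /relev /= !mmapX !mmap1U; exact.
Qed.

Lemma below0 i : below i (fun p => p = 0).
Proof. by move=> Q /y_free -> a _; rewrite rmorph0. Qed.

Lemma vanish_below i Z :
  (forall a, lin_sub i a -> exists v, [/\ Z v, fiber phi b v & forall j, (y j).@[v] = a j]) ->
  below i (vanish Z).
Proof.
move=> HZ Q ZQ a /HZ[v [Zv vb va]]; rewrite -(ZQ v Zv) relpolyE.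
by apply: relev_ext => j; rewrite ?va ?vb.
Qed.

Definition maximal_below i J := [/\ ideal_pred J, below i J &
  forall J', ideal_pred J' -> (forall p, J p -> J' p) -> below i J' -> forall p, J' p -> J p].

Lemma exists_maximal i J0 : ideal_pred J0 -> below i J0 ->
  exists2 J, maximal_below i J & forall p, J0 p -> J p.
Proof.
move=> id0 b0.
pose ok p := forall Q, p = relpoly Q -> forall a, lin_sub i a -> relev b a Q = 0.
have [|J [idJ J0J okJ maxJ]] := @maximal_ideal_pred _ J0 ok id0.
  by move=> p J0p Q pQ; apply: b0; rewrite -pQ.
exists J => //; split=> //; first by move=> Q /okJ/(_ Q erefl).
move=> J' idJ' JJ' bJ'; apply: maxJ => // p J'p Q pQ; apply: bJ'; by rewrite -pQ.
Qed.

(** The vanishing ideal of [zeros J] contains [J] and is again [below], as every point of [L_i]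
    lifts to a zero of [J]; maximality makes the two equal. *)
Lemma maximal_vanish i J p : maximal_below i J -> vanish (zeros J) p -> J p.
Proof.
move=> [idJ bJ maxJ]; apply: maxJ => [|q Jq v|]; [exact: vanish_ideal|exact|].
apply: vanish_below => a La; have [v Hv] := below_over idJ bJ La; by exists v.
Qed.

Lemma maximal_closed i J : maximal_below i J -> zclosed (zeros J).
Proof. by move=> _ v Hv p Jp; apply: Hv => v' /(_ p Jp). Qed.

(** If [p] does not vanish on [zeros J], then by maximality the ideal of [zeros J] cut by [p = 0] is
    not [below]: it contains a [relpoly Q] with [Q] nonzero somewhere on [L_i]. Take [Q'] likewise
    for [q]. If [p * q] vanished, so would [relpoly (Q * Q')], and [Q * Q'] would be zero on the
    irreducible [L_i]. *)
Lemma maximal_prime i J : maximal_below i J -> zprime (zeros J).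
Proof.
move=> mJ p q Zpq; have [idJ bJ maxJ] := mJ.
pose V (t : {mpoly F[n]}) v := zeros J v /\ t.@[v] = 0.
have out t : ~ vanish (zeros J) t -> exists2 Q, vanish (V t) (relpoly Q) &
    exists2 a, lin_sub i a & relev b a Q != 0.
  move=> nt; apply: NNPP => nQ; apply: nt.
  suff Jt : J t by move=> v; apply.
  apply: (maxJ (vanish (V t))) => [|s Js v [/(_ s Js)]||v []] //; first exact: vanish_ideal.
  move=> Q VQ a La; apply: NNPP => /eqP ea; apply: nQ; exists Q => //; by exists a.
apply: NNPP => /not_or_and[/out[Q VQ [a La Qa]] /out[Q' VQ' [a' La' Qa']]].
have prod0 a0 : lin_sub i a0 -> relev b a0 (Q * Q') = 0.
  apply: bJ; apply: (maximal_vanish mJ) => v Zv; rewrite rmorphM mevalM.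
  have /eqP := Zpq v Zv; rewrite mevalM mulf_eq0 => /orP[]/eqP v0.
    by rewrite VQ ?mul0r.
  by rewrite VQ' ?mulr0.
have Lprime : zprime (lin_sub i).
  by apply: line_prime => a1 a2 t L1 L2 j ij; rewrite L1 ?L2 // subrr mulr0 addr0.
have [a0 La0|/(_ a La)|/(_ a' La')] := Lprime (relspec b Q) (relspec b Q').
- by rewrite mevalM !relspecE -rmorphM prod0.
- by rewrite relspecE; apply/eqP.
- by rewrite relspecE; apply/eqP.
Qed.

Lemma lin_sub_le i j a : (i <= j)%N -> lin_sub i a -> lin_sub j a.
Proof. by move=> ij La k jk; apply: La; apply: leq_trans jk. Qed.

(** Cutting [zeros J] by [y_j = 0] for [j >= i] still leaves points over all of [L_i], so the ideal
    of the cut extends to a maximal one. The inclusion is strict at a point over the [i]-th basis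
    vector, where [y_i] is 1. *)
Lemma maximal_step i J : (i < r)%N -> maximal_below i.+1 J ->
  (forall p, vanish (fiber phi b) p -> J p) ->
  exists J', [/\ maximal_below i J', forall p, J p -> J' p &
     exists v, zeros J v /\ ~ zeros J' v].
Proof.
move=> ir [idJ bJ maxJ] fJ.
pose Z v := zeros J v /\ lin_sub i (fun j => (y j).@[v]).
have [||J' mJ' ZJ'] := @exists_maximal i (vanish Z); first exact: vanish_ideal.
  apply: vanish_below => a La.
  have [v [Jv vb va]] := below_over idJ bJ (lin_sub_le (leqnSn i) La).
  by exists v; split=> //; split=> // j ij; rewrite va La.
exists J'; split=> // [p Jp|]; first by apply: ZJ' => v [/(_ p Jp)].
pose a (j : 'I_r) : F := (j == i :> nat)%:R.
have [|v [Jv _ va]] := @below_over i.+1 J a idJ bJ.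
  by move=> j ij; rewrite /a gtn_eqF.
exists v; split=> // /(_ (y (Ordinal ir))) H.
have := oner_neq0 F; rewrite -[1]/(true%:R) -(eqxx i) -[_%:R]/(a (Ordinal ir)) -va H ?eqxx //.
by apply: ZJ' => v' [_ /(_ (Ordinal ir))]; apply.
Qed.

Lemma fiber_chain : exists Z : nat -> ('I_n -> F) -> Prop,
  (forall i, (i <= r)%N -> [/\ zclosed (Z i), zprime (Z i), (exists v, Z i v) &
     forall v, Z i v -> fiber phi b v]) /\
  (forall i, (i < r)%N -> (forall v, Z i v -> Z i.+1 v) /\ exists v, Z i.+1 v /\ ~ Z i v).
Proof.
pose fib J := forall p, vanish (fiber phi b) p -> J p.
suff [K [KP KS]] : exists K : nat -> {mpoly F[n]} -> Prop,
    (forall j, (j <= r)%N -> maximal_below (r - j) (K j) /\ fib (K j)) /\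
    (forall j, (j < r)%N -> (forall p, K j p -> K j.+1 p) /\
       exists v, zeros (K j) v /\ ~ zeros (K j.+1) v).
  (* The ideals are built downwards, [K j] over [L_(r - j)], starting from the vanishing ideal of
     the fiber; the chain of zero sets reverses the index. *)
  exists (fun i => zeros (K (r - i)%N)); split=> [i ir|i ir].
    have [mK fK] := KP (r - i)%N (leq_subr _ _); split.
    - exact: maximal_closed mK.
    - exact: maximal_prime mK.
    - have [idK bK _] := mK.
      have [|v [Kv _ _]] := @below_over _ _ (fun=> 0) idK bK; first by [].
      by exists v.
    - move=> v Kv k; apply/eqP; rewrite -subr_eq0 -[b k](mevalC v) -mevalB; apply/eqP.
      by apply: Kv; apply: fK => v' v'b; rewrite mevalB mevalC v'b subrr.
  have [|KK HK] := KS (r - i.+1)%N; first by rewrite ltn_subrL (leq_ltn_trans _ ir).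
  have E : ((r - i.+1).+1 = r - i)%N by rewrite subnSK.
  by rewrite E in KK HK; split=> // v Kv p /KK; apply: Kv.
suff H k : (k <= r)%N -> exists K : nat -> {mpoly F[n]} -> Prop,
    (forall j, (j <= k)%N -> maximal_below (r - j) (K j) /\ fib (K j)) /\
    (forall j, (j < k)%N -> (forall p, K j p -> K j.+1 p) /\
       exists v, zeros (K j) v /\ ~ zeros (K j.+1) v) by apply: H.
elim: k => [_|k IH kr].
  have [||J mJ fJ] := @exists_maximal r (vanish (fiber phi b)); first exact: vanish_ideal.
    apply: vanish_below => a La.
    have [|v [_ vb va]] := @below_over r _ a _ (@below0 r) La.
      by split=> // [p q -> ->|p q ->]; rewrite ?addr0 ?mulr0.
    by exists v.
  exists (fun=> J); split=> // -[|j] //; by rewrite subn0.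
have [K [KP KS]] := IH (ltnW kr).
have [mK fK] := KP k (leqnn _).
have E : (r - k = (r - k.+1).+1)%N by rewrite subnSK.
rewrite E in mK; have [|J [mJ KJ JS]] := maximal_step _ mK fK.
  by rewrite ltn_subrL (leq_ltn_trans _ kr).
exists (fun j => if j == k.+1 then J else K j); split=> j jk.
  case: eqP => [->|/eqP jk']; first by split=> // p /fK /KJ.
  by apply: KP; rewrite -ltnS ltn_neqAle jk'.
rewrite eqSS ltn_eqF //; case: eqP => [->|/eqP jk'] //.
by apply: KS; rewrite ltn_neqAle jk' -ltnS.
Qed.
End GoodPoint.
End DominantFiber.

Section FiberTheorem.
Variables (F : numClosedFieldType) (n m : nat) (phi : 'I_m -> {mpoly F[n]}).

Theorem generic_fiber : exists2 f : {mpoly F[m]}, f != 0 &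
  forall b, f.@[b] != 0 -> (forall v, ~ fiber phi b v) \/
  exists r, [/\ (r + m = n)%N,
    forall k (g : 'I_k -> {mpoly F[n]}), alg_indep_on (fiber phi b) g -> (k <= r)%N &
    exists Z : nat -> ('I_n -> F) -> Prop,
    (forall i, (i <= r)%N -> [/\ zclosed (Z i), zprime (Z i), (exists v, Z i v) &
       forall v, Z i v -> fiber phi b v]) /\
    (forall i, (i < r)%N ->
       (forall v, Z i v -> Z i.+1 v) /\ exists v, Z i.+1 v /\ ~ Z i v)].
Proof.
have [inj|ninj] := classic (injective (phi_comp phi)); last first.
  have [P P0 phiP] : exists2 P, P != 0 & phi_comp phi P = 0.
    apply: NNPP => noP; apply: ninj => P P' eqP'; apply/eqP; rewrite -subr_eq0.
    apply/negPn/negP => PP'; apply: noP; exists (P - P') => //.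
    by rewrite rmorphB /= eqP' subrr.
  exists P => // b Pb; left=> v vb; move/eqP: Pb; apply.
  rewrite -(@meval_eq _ _ (fun i => (phi i).@[v])) => [|i]; last exact: vb.
  by rewrite -phi_compE phiP meval0.
have [r [y [c [I [w [yfree c0 [l1 wl1] Hw]]]]]] :=
  noether_normalization inj (fun i : 'I_n => 'X_i).
have fin p : finmul (relpoly phi y) w c%:MP p.
  elim/mpoly_ring_ind: p => [d|i|p q Hp Hq|p q Hp Hq]; last 2 first.
  - exact: finmulD.
  - exact: finmulM.
  - rewrite (_ : d%:MP = relpoly phi y (d%:MP%:MP)); first exact: finmul_scalar.
    by rewrite /relpoly /= mmapC /phi_comp /= mmapC.
  exact: Hw.
exists c => // b cb; right; exists r; split.
- apply/eqP; rewrite eqn_leq addnC.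
  by rewrite (dim_le yfree) (dim_ge c0 wl1 inj fin).
- by move=> k g; apply: (fiber_indep wl1 fin cb).
- exact: (fiber_chain yfree wl1 fin cb).
Qed.
End FiberTheorem.

(** * Chains and algebraic independence *)

Section ChainIndep.
Variables (F : numClosedFieldType) (n : nat).

Definition last_uni k : {rmorphism {mpoly F[k.+1]} -> {poly {mpoly F[k]}}} :=
  mmap (polyC \o @mpolyC k F) (fun i => if unlift ord_max i is Some j then ('X_j)%:P else 'X).

Definition extend_last (T : Type) k (g : 'I_k -> T) (t : T) (i : 'I_k.+1) : T :=
  if unlift ord_max i is Some j then g j else t.

Lemma last_uniE n' k (g : 'I_k -> {mpoly F[n']}) t P :
  (map_poly (phi_comp g) (last_uni k P)).[t] = phi_comp (extend_last g t) P.
Proof.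
pose f1 : {rmorphism {mpoly F[k.+1]} -> {mpoly F[n']}} :=
  horner_eval t \o (map_poly (phi_comp g) \o last_uni k).
apply: (rmorph_mpoly_eq (f := f1) (g := phi_comp (extend_last g t))) => [c|i] /=.
  rewrite /last_uni /phi_comp /= !mmapC /= map_polyC /horner_eval hornerC /=.
  by rewrite mmapC.
rewrite /last_uni /= !mmapX !mmap1U /horner_eval /extend_last.
case: unlift => [j|]; last by rewrite map_polyX hornerX.
by rewrite map_polyC hornerC /= mmapX mmap1U.
Qed.

Lemma phi_comp_id k : phi_comp (fun i : 'I_k => 'X_i : {mpoly F[k]}) =1 id.
Proof.
by move=> P; apply/eqP; rewrite -subr_eq0; apply/eqP/mpoly_ext0 => v;
  rewrite mevalB phi_compE; apply/eqP; rewrite subr_eq0; apply/eqP/meval_eq => i; rewrite mevalXU.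
Qed.

Lemma last_uni_eq0 k (P : {mpoly F[k.+1]}) : last_uni k P = 0 -> P = 0.
Proof.
move=> P0; rewrite -(phi_comp_id P).
have := last_uniE (fun j : 'I_k => 'X_(lift ord_max j) : {mpoly F[k.+1]}) 'X_ord_max P.
rewrite P0 rmorph0 horner0 => E; rewrite [RHS]E.
apply/eqP; rewrite -subr_eq0; apply/eqP/mpoly_ext0 => v.
rewrite mevalB !phi_compE; apply/eqP; rewrite subr_eq0; apply/eqP.
by apply: meval_eq => i; rewrite /extend_last; case: unliftP => [j ->|->].
Qed.

(** Write a relation on [Z'] as a polynomial in [t]. On [Z], where [t] vanishes, only the constant
    coefficient survives and must be zero; irreducibility of [Z'] then allows dividing by [t], and
    the degree drops. *)
Lemma alg_indep_extend (Z Z' : ('I_n -> F) -> Prop) k (g : 'I_k -> {mpoly F[n]}) t :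
  (forall v, Z v -> Z' v) -> zprime Z' -> vanish Z t -> ~ vanish Z' t ->
  alg_indep_on Z g -> alg_indep_on Z' (extend_last g t).
Proof.
move=> ZZ' pZ' Zt nZ't gind P HP; apply: last_uni_eq0.
have : vanish Z' (map_poly (phi_comp g) (last_uni k P)).[t].
  move=> v Z'v; rewrite last_uniE phi_compE; exact: HP.
elim/poly_ind: (last_uni k P) => // q c IH.
rewrite rmorphD rmorphM /= map_polyX map_polyC hornerMXaddC => Z'q.
have c0 : c = 0.
  apply: gind => v Zv; have := Z'q v (ZZ' v Zv).
  by rewrite mevalD mevalM (Zt v Zv) mulr0 add0r phi_compE.
rewrite c0 raddf0 addr0 in Z'q; have [/IH ->|//] := pZ' _ _ Z'q.
by rewrite mul0r c0 polyC0 addr0.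
Qed.

Lemma chain_indep (Z : nat -> ('I_n -> F) -> Prop) k :
  (exists v, Z 0%N v) -> (forall i, (i < k)%N -> zprime (Z i.+1)) ->
  (forall i, (i < k)%N -> (forall v, Z i v -> Z i.+1 v) /\
     exists t, vanish (Z i) t /\ ~ vanish (Z i.+1) t) ->
  exists g : 'I_k -> {mpoly F[n]}, alg_indep_on (Z k) g.
Proof.
move=> [v0 Zv0]; elim: k => [|k IH] pZ sZ.
  exists (fun=> 0) => P /(_ v0 Zv0); rewrite [P]nvar0_mpolyC mevalC => ->.
  exact: mpolyC0.
have [||g gind] := IH; [by move=> i ik; apply/pZ/ltnW|by move=> i ik; apply/sZ/ltnW|].
have [ZZ [t [Zt nZt]]] := sZ k (leqnn _).
exists (extend_last g t); exact: (alg_indep_extend ZZ (pZ k (leqnn _)) Zt nZt gind).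
Qed.
End ChainIndep.

(** * Transfer of chains along a chart *)

Section Transfer.
Variables (F : numClosedFieldType) (n : nat) (P : Type).
Variables (closed : (P -> Prop) -> Prop) (Y inchart : P -> Prop).
Variables (fib : ('I_n -> F) -> Prop) (psi : ('I_n -> F) -> P).
Hypothesis closed_bigcap : forall C : (P -> Prop) -> Prop, (exists W, C W) ->
  (forall W, C W -> closed W) -> closed (fun p => forall W, C W -> W p).
Hypothesis psi_in : forall v, fib v -> Y (psi v) /\ inchart (psi v).
Hypothesis psi_onto : forall p, Y p -> inchart p -> exists2 v, fib v & psi v = p.
Hypothesis closed_pull : forall W, closed W -> exists G : {mpoly F[n]} -> Prop,
  forall v, fib v -> (W (psi v) <-> forall g, G g -> g.@[v] = 0).
(** Containing everything outside the chart makes these sets usable in closed covers of [Y]. For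
    [g = 1] the set cuts out exactly the complement of the chart. *)
Hypothesis closed_push : forall g : {mpoly F[n]}, exists W, [/\ closed W,
  forall v, fib v -> (W (psi v) <-> g.@[v] = 0) & forall p, Y p -> ~ inchart p -> W p].

Lemma closed_in_setI Z W : closed_in closed Y Z -> closed W ->
  closed_in closed Y (fun p => Z p /\ W p).
Proof.
move=> [W0 [cW0 ZE]] cW; exists (fun p => forall V, V = W0 \/ V = W -> V p); split.
  by apply: closed_bigcap => [|V [->|->]] //; exists W; right.
move=> p; split=> [[/ZE[Yp W0p] Wp]|[Yp H]]; first by split=> // V [->|->].
by split; [apply/ZE; split=> //|]; apply: H; [left|right].
Qed.

Definition pull (Z : P -> Prop) v := fib v /\ Z (psi v).

Lemma closed_in_sub Z p : closed_in closed Y Z -> Z p -> Y p.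
Proof. by move=> [W [_ ZE]] /ZE[]. Qed.

(** If [p * q] vanishes on the trace, [Z] is covered by its intersections with the closed sets of
    [p] and of [q], the points outside the chart being in both. *)
Lemma pull_prime Z : irreducible_in closed Y Z -> zprime (pull Z).
Proof.
move=> [cZ [_ irr]] p q Vpq.
have [Wp [cWp WpE Wp_out]] := closed_push p; have [Wq [cWq WqE Wq_out]] := closed_push q.
have cover z : Z z -> (Z z /\ Wp z) \/ (Z z /\ Wq z).
  move=> Zz; have Yz := closed_in_sub cZ Zz.
  have [/(psi_onto Yz)[v fv vz]|out] := classic (inchart z); last first.
    by left; split=> //; apply: Wp_out.
  move: Zz; rewrite -vz => Zz; have /eqP := Vpq v (conj fv Zz).
  by rewrite mevalM mulf_eq0 => /orP[]/eqP v0; [left|right]; split=> //; [apply/WpE|apply/WqE].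
have [z []//|z []//|sub|sub] := irr _ _ (closed_in_setI cZ cWp) (closed_in_setI cZ cWq) _ _ cover.
  by left=> v [fv /sub[_ /(WpE v fv)]].
by right=> v [fv /sub[_ /(WqE v fv)]].
Qed.

(** Were the two traces to satisfy the same equations, [Z'] would be covered by [Z] and the
    complement of the chart. Irreducibility leaves one of them: the first contradicts strictness,
    the second the point [p0]. *)
Lemma pull_strict Z Z' p0 : closed_in closed Y Z -> irreducible_in closed Y Z' ->
  psubsetP Z Z' -> Z' p0 -> inchart p0 ->
  exists t, vanish (pull Z) t /\ ~ vanish (pull Z') t.
Proof.
move=> cZ [cZ' [_ irr]] [ZZ' [z [Z'z nZz]]] Z'p0 p0c; apply: NNPP => no_t.
have [W [cW ZE]] := cZ; have [G HG] := closed_pull cW.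
have [W1 [cW1 W1E W1_out]] := closed_push 1.
have cover x : Z' x -> Z x \/ (Z' x /\ W1 x).
  move=> Z'x; have Yx := closed_in_sub cZ' Z'x.
  have [/(psi_onto Yx)[v fv vx]|out] := classic (inchart x); last first.
    by right; split=> //; apply: W1_out.
  left; apply/ZE; split=> //; rewrite -vx; apply/HG => // g Gg.
  apply: NNPP => gv; apply: no_t; exists g; split.
    by move=> v' [fv' /ZE[_ /(HG v' fv')]]; apply.
  by move/(_ v) => H; apply: gv; apply: H; split=> //; rewrite vx.
have [||H|H] := irr _ _ cZ (closed_in_setI cZ' cW1) _ _ cover; first exact: ZZ'.
- by move=> x [].
- exact: nZz (H _ Z'z).
have [_ W1p0] := H _ Z'p0; have [v fv vp0] := psi_onto (closed_in_sub cZ' Z'p0) p0c.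
move: W1p0; rewrite -vp0 => /(W1E v fv)/eqP.
by rewrite meval1 oner_eq0.
Qed.

(** A point of the smallest member lies in every member, so the whole chain meets the chart and its
    traces yield [k] independent functions. *)
Lemma chain_length_le k r (Z : nat -> P -> Prop) p0 :
  (forall k' (g : 'I_k' -> {mpoly F[n]}), alg_indep_on fib g -> (k' <= r)%N) ->
  (forall i, (i <= k)%N -> irreducible_in closed Y (Z i)) ->
  (forall i, (i < k)%N -> psubsetP (Z i) (Z i.+1)) ->
  Z 0%N p0 -> inchart p0 -> (k <= r)%N.
Proof.
move=> ind irrZ subZ Z0p0 p0c.
have Zp0 i : (i <= k)%N -> Z i p0.
  by elim: i => // i IH ik; have [+ _] := subZ i ik; apply; apply/IH/ltnW.
have [|||g gind] := @chain_indep F n (fun i => pull (Z i)) k.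
- have [cZ0 _] := irrZ 0%N (leq0n _).
  have [v fv vp0] := psi_onto (closed_in_sub cZ0 Z0p0) p0c.
  by exists v; split=> //; rewrite vp0.
- by move=> i ik; apply/pull_prime/irrZ.
- move=> i ik; split; first by move=> v [fv Zv]; split=> //; apply: (subZ i ik).1.
  exact: pull_strict (irrZ i (ltnW ik)).1 (irrZ i.+1 ik) (subZ i ik) (Zp0 _ ik) p0c.
by apply: (ind _ g) => Q HQ; apply: gind => v [fv _]; apply: HQ.
Qed.

(* The closure of psi(V) in Y. *)
Definition push (V : ('I_n -> F) -> Prop) p :=
  Y p /\ forall W, closed W /\ (forall v, V v -> W (psi v)) -> W p.

Lemma push_closed V : (forall v, V v -> fib v) -> closed_in closed Y (push V).
Proof.
move=> Vfib; exists (fun p => forall W, closed W /\ (forall v, V v -> W (psi v)) -> W p).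
split=> //; apply: closed_bigcap => [|W []//].
have [W [cW WE _]] := closed_push 0; exists W; split=> // v Vv.
by apply/WE; [exact: Vfib|rewrite meval0].
Qed.

Lemma push_psi V v : (forall v, V v -> fib v) -> V v -> push V (psi v).
Proof. by move=> Vfib Vv; split=> [|W [_ ]]; [case: (psi_in (Vfib v Vv))|apply]. Qed.

(** If neither closed piece contained the closure, each would have an equation not vanishing on [V],
    while the product of the two equations vanishes there. *)
Lemma push_irreducible V : (forall v, V v -> fib v) -> zprime V -> (exists v, V v) ->
  irreducible_in closed Y (push V).
Proof.
move=> Vfib pV [v0 Vv0]; split; first exact: push_closed.
split; first by exists (psi v0); apply: push_psi.
move=> Z1 Z2 [W1 [cW1 Z1E]] [W2 [cW2 Z2E]] _ _ cover.
have [G1 HG1] := closed_pull cW1; have [G2 HG2] := closed_pull cW2.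
have out G : ~ (forall g, G g -> vanish V g) -> exists g, G g /\ ~ vanish V g.
  exact: not_forall_imply.
have sub W Z (G : {mpoly F[n]} -> Prop) : closed W -> (forall x, Z x <-> Y x /\ W x) ->
    (forall v, fib v -> W (psi v) <-> forall g, G g -> g.@[v] = 0) ->
    (forall g, G g -> vanish V g) -> Defs.subsetP (push V) Z.
  move=> cW ZE HG GV p [Yp Hp]; apply/ZE; split=> //; apply: Hp; split=> // v Vv.
  by apply/HG => [|g /GV]; [exact: Vfib|apply].
apply: NNPP => /not_or_and[n1 n2].
have [|g1 [Gg1 nV1]] := out G1; first by move/(sub _ _ _ cW1 Z1E HG1)/n1.
have [|g2 [Gg2 nV2]] := out G2; first by move/(sub _ _ _ cW2 Z2E HG2)/n2.
have [v Vv||] // := pV g1 g2.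
rewrite mevalM; have [/Z1E[_]|/Z2E[_]] := cover _ (push_psi Vfib Vv).
  by move/(HG1 v (Vfib v Vv)) => /(_ g1 Gg1) ->; rewrite mul0r.
by move/(HG2 v (Vfib v Vv)) => /(_ g2 Gg2) ->; rewrite mulr0.
Qed.

(** Taking the closure adds no point inside the chart: each polynomial vanishing on the closed [V]
    gives a closed set that contains [push V]. *)
Lemma push_strict V V' : (forall v, V' v -> fib v) -> zclosed V ->
  (forall v, V v -> V' v) -> (exists v, V' v /\ ~ V v) -> psubsetP (push V) (push V').
Proof.
move=> V'fib cV VV' [v [V'v nVv]].
have Vfib v' : V v' -> fib v' by move/VV'/V'fib.
split.
  by move=> p [Yp Hp]; split=> // W [cW WV']; apply: Hp; split=> // v' /VV'/WV'.
exists (psi v); split; first exact: push_psi.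
move=> [_ Hv]; apply: nVv; apply: cV => p Vp.
have [W [cW WE _]] := closed_push p; apply/WE; first exact: V'fib.
by apply: Hv; split=> // v' Vv'; apply/WE; [exact: Vfib|exact: Vp].
Qed.

Lemma push_chain r (V : nat -> ('I_n -> F) -> Prop) :
  (forall i, (i <= r)%N -> [/\ zclosed (V i), zprime (V i), (exists v, V i v) &
     forall v, V i v -> fib v]) ->
  (forall i, (i < r)%N -> (forall v, V i v -> V i.+1 v) /\ exists v, V i.+1 v /\ ~ V i v) ->
  irr_chain closed Y r.
Proof.
move=> HV sV; exists (fun i => push (V i)); split=> i ir.
  by have [cV pV neV fV] := HV i ir; apply: push_irreducible.
have [cV _ _ _] := HV i (ltnW ir); have [_ _ _ fV'] := HV i.+1 ir.
by have [VV' ex] := sV i ir; apply: push_strict.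
Qed.
End Transfer.

(** * Charts of the incidence variety *)

Lemma card_tagged_sub (I : finType) (T : I -> finType) (P : pred {i : I & T i}) :
  #|{: {t : {i : I & T i} | P t}}| = (\sum_i #|[pred x | P (existT _ i x) ]|)%N.
Proof.
rewrite card_sig -sum1_card (eq_bigr (fun i => \sum_(x : T i | P (existT _ i x)) 1)%N).
  by rewrite (sig_big_dep predT (fun i (x : T i) => P (existT _ i x)) (fun _ _ => 1%N)) /=;
    apply: eq_bigl => -[].
by move=> i _; rewrite sum1_card.
Qed.

Lemma card_notin_codom a b (f : 'I_a -> 'I_b) : injective f ->
  #|[pred y | y \notin codom f]| = (b - a)%N.
Proof.
move=> f_inj; have := cardC (mem (codom f)); rewrite card_codom // !card_ord => E.
by rewrite -[RHS](congr1 (subn^~ a) E) /= addKn; apply: eq_card.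
Qed.

Section Pivot.
Variables (K : nat) (d D : 'I_K -> nat) (f : forall i, 'I_(d i) -> 'I_(D i)).
Hypothesis f_inj : forall i, injective (@f i).

(** Positions in nonpivot columns, the affine coordinates of a product of Grassmannian charts. *)
Definition pivT := {t : {i : 'I_K & ('I_(d i) * 'I_(D i))%type} |
  (tagged t).2 \notin codom (@f (tag t))}.

Lemma card_pivT : #|{: pivT}| = (\sum_i d i * (D i - d i))%N.
Proof.
rewrite card_tagged_sub; apply: eq_bigr => i _ /=.
rewrite -[X in (X * _)%N]card_ord -(card_notin_codom (@f_inj i)) -cardX.
by apply: eq_card => -[x y]; rewrite !inE.
Qed.

Section Ring.
Variable A : comNzRingType.

Definition pivE i : 'M[A]_(d i, D i) := \matrix_(k, b) (b == f k)%:R.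

Definition pivX (x : pivT -> A) i : 'M[A]_(d i, D i) :=
  \matrix_(k, b) oapp x 0 (insub (Tagged (fun i => ('I_(d i) * 'I_(D i))%type) (k, b))).

Definition chartM x i := pivE i + pivX x i.

Lemma mul_pivE_tr m i (X : 'M_(m, D i)) k l : (X *m (pivE i)^T) k l = X k (f l).
Proof.
rewrite mxE (bigD1 (f l)) //= !mxE eqxx mulr1 big1 ?addr0 // => b bl.
by rewrite !mxE (negPf bl) mulr0.
Qed.

Lemma pivEE i : pivE i *m (pivE i)^T = 1%:M.
Proof. by apply/matrixP => k l; rewrite mul_pivE_tr !mxE (inj_eq (@f_inj i)) eq_sym. Qed.

Lemma pivXE x i : pivX x i *m (pivE i)^T = 0.
Proof.
apply/matrixP => k l; rewrite mul_pivE_tr !mxE insubF //=.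
by rewrite codom_f.
Qed.

Lemma chartME x i : chartM x i *m (pivE i)^T = 1%:M.
Proof. by rewrite mulmxDl pivEE pivXE addr0. Qed.

Lemma chartM_coord (X : forall i, 'M[A]_(d i, D i)) :
  (forall i, X i *m (pivE i)^T = 1%:M) ->
  forall i, chartM (fun t => X (tag (val t)) (tagged (val t)).1 (tagged (val t)).2) i = X i.
Proof.
move=> XE i; apply/matrixP => k b; rewrite !mxE.
case: insubP => [t _ tE|] /=.
  rewrite tE /= [_ == _]negbTE ?add0r //; apply: contraTneq (svalP t) => bE.
  by rewrite tE /= bE negbK codom_f.
rewrite negbK => /codomP[l ->].
by rewrite addr0 (inj_eq (@f_inj i)) -mul_pivE_tr XE mxE eq_sym.
Qed.

Lemma chartM_entry x (t : pivT) :
  chartM x (tag (val t)) (tagged (val t)).1 (tagged (val t)).2 = x t.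
Proof.
rewrite !mxE [_ == _]negbTE; last first.
  by apply: contraTneq (svalP t) => ->; rewrite negbK codom_f.
by rewrite add0r; case: t => -[i [k b]] /= H; rewrite insubT.
Qed.
End Ring.

Lemma map_chartM (A B : comNzRingType) (g : {rmorphism A -> B}) x i :
  map_mx g (chartM x i) = chartM (g \o x) i.
Proof.
apply/matrixP => k b; rewrite !mxE rmorphD rmorph_nat; congr (_ + _).
by case: insub => [t|] //=; rewrite rmorph0.
Qed.
End Pivot.

(** * Solving the interference equations for the pivot entries *)

Section Channel.
Variables (K : nat) (d M N : 'I_K -> nat).
Variables (fU : forall i, 'I_(d i) -> 'I_(M i)) (fV : forall i, 'I_(d i) -> 'I_(N i)).
Hypotheses (fU_inj : forall i, injective (@fU i)) (fV_inj : forall i, injective (@fV i)).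

Let entry := {ij : 'I_K * 'I_K & ('I_(N ij.1) * 'I_(M ij.2))%type}.
Definition offT := {t : entry | (tag t).1 != (tag t).2}.
Definition freeT := {t : entry | ((tag t).1 != (tag t).2) &&
  ~~ (((tagged t).1 \in codom (@fV (tag t).1)) && ((tagged t).2 \in codom (@fU (tag t).2)))}.
Definition coordT := (pivT fU + pivT fV + freeT)%type.

Lemma sum_offdiag (g : 'I_K -> 'I_K -> nat) :
  (\sum_i \sum_(j | j != i) g i j = \sum_(p : 'I_K * 'I_K) if p.2 != p.1 then g p.1 p.2 else 0)%N.
Proof. by rewrite pair_big_dep big_mkcond. Qed.

Lemma card_offT :
  #|{: offT}| = (\sum_i \sum_(j | j != i) N i * M j)%N.
Proof.
rewrite card_tagged_sub sum_offdiag; apply: eq_bigr => -[i j] _ /=.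
rewrite [j == i]eq_sym; case: eqP => [_|_] /=; first by rewrite eq_card0.
by rewrite (eq_card (B := predT)) // card_prod !card_ord.
Qed.

Lemma card_freeT :
  (#|{: freeT}| + \sum_i \sum_(j | j != i) d i * d j = #|{: offT}|)%N.
Proof.
rewrite card_offT card_tagged_sub !sum_offdiag -big_split; apply: eq_bigr => -[i j] _ /=.
rewrite [j == i]eq_sym; case: eqP => [_|_] /=; first by rewrite eq_card0.
pose B := [pred x : 'I_(N i) * 'I_(M j) | (x.1 \in codom (@fV i)) && (x.2 \in codom (@fU j))].
have <- : #|B| = (d i * d j)%N.
  have := cardX (mem (codom (@fV i))) (mem (codom (@fU j))).
  by rewrite (card_codom (@fV_inj i)) (card_codom (@fU_inj j)) !card_ord => <-; apply: eq_card.
have := cardC B; rewrite card_prod !card_ord => <-; rewrite addnC.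
by congr (_ + _)%N; apply: eq_card.
Qed.

(** This is the computation of [n - m], with [m] the size of [offT]; it is kept additive because
    subtracting the interference terms in [nat] would truncate. *)
Lemma card_coordT :
  (#|{: coordT}| + \sum_i \sum_(j | j != i) d i * d j =
   \sum_i d i * (M i - d i) + \sum_i d i * (N i - d i) + #|{: offT}|)%N.
Proof. by rewrite !card_sum -addnA card_freeT !card_pivT. Qed.

Section Ring.
Variable A : comNzRingType.
Implicit Types (x : coordT -> A).

Definition cU x i : 'M[A]_(d i, M i) := chartM (fun t : pivT fU => x (inl (inl t))) i.
Definition cV x i : 'M[A]_(d i, N i) := chartM (fun t : pivT fV => x (inl (inr t))) i.
Definition cH0 x i j : 'M[A]_(N i, M j) := \matrix_(a, b) oapp (fun t : freeT => x (inr t)) 0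
  (insub (Tagged (fun ij : 'I_K * 'I_K => ('I_(N ij.1) * 'I_(M ij.2))%type)
     (i := (i, j)) (a, b))).
(* The free entries of H_ij determine the pivot ones through V_i H_ij U_j^T = 0. *)
Definition cH x i j := cH0 x i j -
  (pivE fV A i)^T *m (cV x i *m cH0 x i j *m (cU x j)^T) *m pivE fU A j.


(** Such a product places [Q] in the block of pivot rows and columns and zeros elsewhere, as the
    next two lemmas read off. *)
Lemma pivE_sandwich i j (Q : 'M[A]_(d i, d j)) a b :
  ((pivE fV A i)^T *m Q *m pivE fU A j) a b =
  \sum_k \sum_l (a == fV k)%:R * Q k l * (b == fU l)%:R.
Proof.
rewrite mxE exchange_big /=; apply: eq_bigr => l _.
rewrite !mxE mulr_suml; apply: eq_bigr => k _; by rewrite !mxE.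
Qed.

Lemma sandwich_pivot i j (Q : 'M[A]_(d i, d j)) k l :
  ((pivE fV A i)^T *m Q *m pivE fU A j) (fV k) (fU l) = Q k l.
Proof.
rewrite pivE_sandwich (bigD1 k) //= (bigD1 l) //= !eqxx mul1r mulr1.
rewrite !big1 ?addr0 // => [k' kk|l' ll].
  by rewrite big1 // => l' _; rewrite (inj_eq (@fV_inj i)) eq_sym (negPf kk) !mul0r.
by rewrite (inj_eq (@fU_inj j)) [_ == l']eq_sym (negPf ll) mulr0.
Qed.

Lemma sandwich_free i j (Q : 'M[A]_(d i, d j)) a b :
  ~~ ((a \in codom (@fV i)) && (b \in codom (@fU j))) ->
  ((pivE fV A i)^T *m Q *m pivE fU A j) a b = 0.
Proof.
move=> nab; rewrite pivE_sandwich big1 // => k _; rewrite big1 // => l _.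
case: eqP nab => [->|_ _]; last by rewrite !mul0r.
by case: eqP => [->|_ _]; rewrite ?codom_f // mulr0.
Qed.

(** [cV] and [cU] are identities on the pivots, so the correction term contributes exactly the value
    of [cH0] that it has to cancel. *)
Lemma cH_annihilates x i j : cV x i *m cH x i j *m (cU x j)^T = 0.
Proof.
have EU : pivE fU A j *m (cU x j)^T = 1%:M.
  by rewrite -[LHS]trmxK trmx_mul trmxK chartME // trmx1.
rewrite /cH mulmxBr mulmxBl !mulmxA chartME // mul1mx -!mulmxA EU mulmx1.
by rewrite subrr.
Qed.

Lemma cH_free x (t : freeT) :
  cH x (tag (val t)).1 (tag (val t)).2 (tagged (val t)).1 (tagged (val t)).2 = x (inr t).
Proof.
case/andP: (svalP t) => tij tfree.
rewrite mxE [X in _ + X]mxE sandwich_free // subr0 mxE.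
case: t tij tfree => -[[i j] [a b]] /= H tij tfree.
by rewrite insubT.
Qed.

(** Uniqueness of the solution: [h] is its free part plus its pivot block [Q], and annihilation
    forces [Q] to be minus the value of the free part. *)
Lemma cH_coord x (h : forall i j, 'M[A]_(N i, M j)) i j :
  i != j -> cV x i *m h i j *m (cU x j)^T = 0 ->
  (forall t, x (inr t) = h (tag (val t)).1 (tag (val t)).2 (tagged (val t)).1 (tagged (val t)).2) ->
  cH x i j = h i j.
Proof.
move=> ij ann xh.
have EU : pivE fU A j *m (cU x j)^T = 1%:M.
  by rewrite -[LHS]trmxK trmx_mul trmxK chartME // trmx1.
pose Q := \matrix_(k, l) h i j (fV k) (fU l) : 'M[A]_(d i, d j).
have hE : h i j = cH0 x i j + (pivE fV A i)^T *m Q *m pivE fU A j.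
  apply/matrixP => a b; rewrite mxE [X in _ = X + _]mxE.
  case: insubP => [t _ tE|] /=.
    rewrite xh tE /= sandwich_free ?addr0 //.
    by have /andP[_] := valP t; rewrite tE.
  rewrite ij /= negbK => /andP[/codomP[k ->] /codomP[l ->]].
  by rewrite sandwich_pivot mxE add0r.
have QE : cV x i *m cH0 x i j *m (cU x j)^T = - Q.
  move: ann; rewrite {1}hE mulmxDr mulmxDl !mulmxA chartME // mul1mx -[Q *m _ *m _]mulmxA EU mulmx1.
  by move/eqP; rewrite addr_eq0 => /eqP.
by rewrite /cH QE mulmxN mulNmx opprK -hE.
Qed.
End Ring.

Section Morphism.
Variables (A B : comNzRingType) (g : {rmorphism A -> B}).

Lemma map_cU x i : map_mx g (cU x i) = cU (g \o x) i.
Proof. exact: map_chartM. Qed.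

Lemma map_cV x i : map_mx g (cV x i) = cV (g \o x) i.
Proof. exact: map_chartM. Qed.

Lemma map_cH x i j : map_mx g (cH x i j) = cH (g \o x) i j.
Proof.
have map_pivE D (f : forall i, 'I_(d i) -> 'I_(D i)) k : map_mx g (pivE f A k) = pivE f B k.
  by apply/matrixP => a b; rewrite !mxE rmorph_nat.
have map_cH0 : map_mx g (cH0 x i j) = cH0 (g \o x) i j.
  by apply/matrixP => a b; rewrite !mxE; case: insub => [t|] //=; rewrite rmorph0.
by rewrite /cH map_mxB !map_mxM -!map_trmx !map_pivE map_cH0 map_cU map_cV.
Qed.
End Morphism.
End Channel.

(** * Grassmannians *)

Section Polyfun.
Variables (F : fieldType) (T : Type) (coords : (T -> F) -> Prop).

Lemma polyfun_ext f g : polyfun coords f -> f =1 g -> polyfun coords g.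
Proof. by move=> pf /functional_extensionality <-. Qed.

Lemma polyfun_sum (I : Type) (s : seq I) (P : pred I) (f : I -> T -> F) :
  (forall i, P i -> polyfun coords (f i)) ->
  polyfun coords (fun x => \sum_(i <- s | P i) f i x).
Proof.
move=> pf; elim: s => [|i s IH].
  by apply: polyfun_ext (pf_const _ 0) _ => x; rewrite big_nil.
case Pi: (P i); last by apply: polyfun_ext IH _ => x; rewrite big_cons Pi.
by apply: polyfun_ext (pf_add (pf i Pi) IH) _ => x; rewrite big_cons Pi.
Qed.

Lemma polyfun_prod (I : Type) (s : seq I) (P : pred I) (f : I -> T -> F) :
  (forall i, P i -> polyfun coords (f i)) ->
  polyfun coords (fun x => \prod_(i <- s | P i) f i x).
Proof.
move=> pf; elim: s => [|i s IH].
  by apply: polyfun_ext (pf_const _ 1) _ => x; rewrite big_nil.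
case Pi: (P i); last by apply: polyfun_ext IH _ => x; rewrite big_cons Pi.
by apply: polyfun_ext (pf_mul (pf i Pi) IH) _ => x; rewrite big_cons Pi.
Qed.

Definition polymx m n (A : T -> 'M[F]_(m, n)) := forall i j, polyfun coords (fun x => A x i j).

Lemma polymx_const m n (A : 'M[F]_(m, n)) : polymx (fun=> A).
Proof. by move=> i j; apply: pf_const. Qed.

Lemma polymx_mul m n p (A : T -> 'M[F]_(m, n)) (B : T -> 'M[F]_(n, p)) :
  polymx A -> polymx B -> polymx (fun x => A x *m B x).
Proof.
move=> pA pB i j; apply: (@polyfun_ext (fun x => \sum_k A x i k * B x k j)).
  by apply: polyfun_sum => k _; apply: pf_mul.
by move=> x; rewrite mxE.
Qed.

Lemma polyfun_det n (A : T -> 'M[F]_n) : polymx A -> polyfun coords (fun x => \det (A x)).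
Proof.
move=> pA; apply: polyfun_sum => s _; apply: pf_mul; first exact: pf_const.
by apply: polyfun_prod => i _; apply: pA.
Qed.

Lemma polymx_adj n (A : T -> 'M[F]_n) : polymx A -> polymx (fun x => \adj (A x)).
Proof.
move=> pA i j; apply: (@polyfun_ext (fun x => cofactor (A x) j i)); last by move=> x; rewrite mxE.
apply: pf_mul; first exact: pf_const.
apply: polyfun_det => k l; apply: polyfun_ext (pA (lift j k) (lift i l)) _ => x.
by rewrite !mxE.
Qed.
End Polyfun.

Lemma mul_row_entry (F : fieldType) k l p q (A : 'M[F]_(k, p)) (B : 'M_(p, q))
    (D : 'M_(l, q)) a b :
  (row a A *m B *m (row b D)^T) 0 0 = (A *m B *m D^T) a b.
Proof. rewrite !mxE; apply: eq_bigr => c _; rewrite !mxE; congr (_ * _).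
by apply: eq_bigr => e _; rewrite !mxE. Qed.

Section Grassmann.
Variables (R : realType) (K : nat) (d M N : 'I_K -> nat).
Local Notation C := (R[i]).
Local Notation strat := (strat R M N).
Local Notation stiefel := (stiefel R d M N).
Local Notation grass_closed := (@grass_closed R K d M N).

(** The equations are all polynomials vanishing on one of the sets. The family is nonempty since a
    closed set may contain only points. *)
Lemma grass_closed_bigcap (Q : (strat -> Prop) -> Prop) : (exists W, Q W) ->
  (forall W, Q W -> grass_closed W) -> grass_closed (fun p => forall W, Q W -> W p).
Proof.
move=> [W0 QW0] Qc; split; first by move=> p /(_ W0 QW0); apply: (Qc W0 QW0).1.
exists (fun f => polyfun (@scoords R K d M N) f /\
  exists2 W, Q W & forall X, is_stiefel X -> W (stiefel_proj X) -> f X = 0).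
split=> [f []//|X sX]; split=> [H f [_ [W QW]]|H W QW]; first by apply=> //; apply: H.
have [_ [Fs [pFs HFs]]] := Qc W QW; apply/(HFs X sX) => f Ff; apply: H.
split; first exact: pFs.
by exists W => // X' sX' /(HFs X' sX'); apply.
Qed.

Lemma genmx_row_free k m (A : 'M[C]_m) : <<A>>%MS = A -> \rank A = k ->
  exists2 B : 'M[C]_(k, m), row_free B & <<B>>%MS = A.
Proof.
move=> gA <-; exists (row_base A); first exact: row_base_free.
by rewrite -[RHS]gA; apply/genmxP/eqmxP; apply: eq_row_base.
Qed.

Lemma stiefel_projP (p : strat) : is_point d p ->
  exists2 X : stiefel, is_stiefel X & stiefel_proj X = p.
Proof.
move=> pp.
have HU i : exists B : 'M[C]_(d i, M i), row_free B /\ <<B>>%MS = SU p i.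
  by have [[gU rU] _] := pp i; have [B fB gB] := genmx_row_free gU rU; exists B.
have HV i : exists B : 'M[C]_(d i, N i), row_free B /\ <<B>>%MS = SV p i.
  by have [_ [gV rV]] := pp i; have [B fB gB] := genmx_row_free gV rV; exists B.
have [U HU'] := fin_all_exists HU; have [V HV'] := fin_all_exists HV.
exists (U, V) => [i|]; first by have [? _] := HU' i; have [? _] := HV' i.
case: p {pp HU HV} HU' HV' => pU pV HU HV; rewrite /stiefel_proj /=.
by congr Strat; apply: functional_extensionality_dep => i; [case: (HU i)|case: (HV i)].
Qed.

Lemma stiefel_point (X : stiefel) : is_stiefel X -> is_point d (stiefel_proj X).
Proof.
by move=> sX i; have [/eqP rU /eqP rV] := sX i; rewrite /= !genmx_id !mxrank_gen rU rV.
Qed.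

Lemma genmx_eq_mul k m (A B : 'M[C]_(k, m)) : row_free A -> <<A>>%MS = <<B>>%MS ->
  exists2 g : 'M[C]_k, g \in unitmx & A = g *m B.
Proof.
move=> fA /genmxP/andP[/submxP[g AE] _]; exists g => //.
rewrite -row_free_unit -kermx_eq0; apply/eqP.
have : kermx g *m A = 0 by rewrite AE mulmxA mulmx_ker mul0mx.
by move/(congr1 (mulmx^~ (pinvmx A))); rewrite mulmxKp // mul0mx.
Qed.

Lemma feasible_proj h (X : stiefel) : is_stiefel X ->
  feasible d h (stiefel_proj X) <->
  forall i j, i != j -> X.2 i *m h i j *m (X.1 j)^T = 0.
Proof.
move=> sX; split=> [[_ H] i j ij|H].
  apply/matrixP => a b; have := H i j ij (row a (X.2 i)) (row b (X.1 j)).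
  rewrite /= !genmxE !row_sub => /(_ isT isT)/matrixP/(_ 0 0).
  by rewrite mul_row_entry !mxE.
split; first exact: stiefel_point.
move=> i j ij v u; rewrite /= !genmxE => /submxP[a ->] /submxP[b ->].
by rewrite trmx_mul !mulmxA -[a *m _ *m _]mulmxA -[a *m _ *m _]mulmxA H // mulmx0 mul0mx.
Qed.
End Grassmann.

Lemma invmx_mul_cancel (F : fieldType) k l (g A : 'M[F]_k) (B : 'M[F]_(k, l)) :
  g \in unitmx -> A \in unitmx -> invmx (g *m A) *m (g *m B) = invmx A *m B.
Proof.
move=> ug uA; rewrite -[LHS](mulKmx uA); congr (_ *m _); apply: (can_inj (mulKmx ug)).
by rewrite mulmxA mulKVmx // unitmx_mul ug.
Qed.

(** * Chart maps between feasible strategies and affine space *)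

Section Chart.
Variables (R : realType) (K : nat) (d M N : 'I_K -> nat).
Local Notation C := (R[i]).
Local Notation strat := (strat R M N).
Local Notation stiefel := (stiefel R d M N).
Local Notation grass_closed := (@grass_closed R K d M N).
Local Notation scoords := (@scoords R K d M N).
Local Notation hspace := (hspace R M N).
Variables (fU : forall i, 'I_(d i) -> 'I_(M i)) (fV : forall i, 'I_(d i) -> 'I_(N i)).
Hypotheses (fU_inj : forall i, injective (@fU i)) (fV_inj : forall i, injective (@fV i)).

Local Notation coordT := (coordT fU fV).
Local Notation n := #|{: coordT}|.
Local Notation m := #|{: offT M N}|.

Definition coord (A : Type) (v : 'I_n -> A) (t : coordT) := v (enum_rank t).

Definition stief (v : 'I_n -> C) : stiefel := (cU (coord v), cV (coord v)).

(** The map phi of the overview, obtained by running [cH] over the polynomial ring at the tuple of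
    variables. *)
Definition chan (k : 'I_m) : {mpoly C[n]} :=
  let t := val (enum_val k) in
  cH (coord (fun k => 'X_k)) (tag t).1 (tag t).2 (tagged t).1 (tagged t).2.

Definition offdiag (h : hspace) (k : 'I_m) : C :=
  let t := val (enum_val k) in h (tag t).1 (tag t).2 (tagged t).1 (tagged t).2.

(** A Plücker coordinate: the maximal minor on the pivot columns. The chart is where all these
    minors are nonzero. *)
Definition pdetU (X : stiefel) i := \det (X.1 i *m (pivE fU C i)^T).
Definition pdetV (X : stiefel) i := \det (X.2 i *m (pivE fV C i)^T).
Definition pdet X := \prod_i pdetU X i * \prod_i pdetV X i.

Definition nU (X : stiefel) i := invmx (X.1 i *m (pivE fU C i)^T) *m X.1 i.
Definition nV (X : stiefel) i := invmx (X.2 i *m (pivE fV C i)^T) *m X.2 i.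

Definition chart_pt (h : hspace) (X : stiefel) (k : 'I_n) : C :=
  match enum_val k with
  | inl (inl t) => nU X (tag (val t)) (tagged (val t)).1 (tagged (val t)).2
  | inl (inr t) => nV X (tag (val t)) (tagged (val t)).1 (tagged (val t)).2
  | inr t => h (tag (val t)).1 (tag (val t)).2 (tagged (val t)).1 (tagged (val t)).2
  end.

Definition in_chart (p : strat) :=
  exists X, [/\ is_stiefel X, stiefel_proj X = p & pdet X != 0].

Lemma coord_X_meval (v : 'I_n -> C) :
  meval v \o coord (fun k => 'X_k : {mpoly C[n]}) =1 coord v.
Proof. by move=> t; rewrite /= /coord mevalXU. Qed.

Lemma chanE (v : 'I_n -> C) k : (chan k).@[v] = offdiag (fun i j => cH (coord v) i j) k.
Proof.
rewrite /chan /offdiag; set t := val _.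
have := map_cH (meval v) (coord (fun k => 'X_k : {mpoly C[n]})) (tag t).1 (tag t).2.
rewrite (functional_extensionality _ _ (coord_X_meval v)).
by move/matrixP/(_ (tagged t).1 (tagged t).2); rewrite [LHS]mxE.
Qed.

Lemma fiberP h v : fiber chan (offdiag h) v <-> forall i j, i != j -> cH (coord v) i j = h i j.
Proof.
split=> [H i j ij|H k]; last first.
  by rewrite chanE /offdiag H //; apply: (valP (enum_val k)).
apply/matrixP => a b.
pose t : offT M N := Sub (existT (fun ij : 'I_K * 'I_K => ('I_(N ij.1) * 'I_(M ij.2))%type)
  (i, j) (a, b)) ij.
by have := H (enum_rank t); rewrite chanE /offdiag enum_rankK.
Qed.

Lemma stief_pivot v : (forall i, (stief v).1 i *m (pivE fU C i)^T = 1%:M) /\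
  (forall i, (stief v).2 i *m (pivE fV C i)^T = 1%:M).
Proof. by split=> i; rewrite chartME. Qed.

Lemma row_free_pivot k l (A : 'M[C]_(k, l)) B : A *m B = 1%:M -> row_free A.
Proof. by move=> AB; apply/row_freeP; exists B. Qed.

Lemma stief_stiefel v : is_stiefel (stief v).
Proof.
have [HU HV] := stief_pivot v.
by move=> i; split; [apply: row_free_pivot (HU i)|apply: row_free_pivot (HV i)].
Qed.

Lemma stief_pdet v : pdet (stief v) != 0.
Proof.
have [HU HV] := stief_pivot v; rewrite /pdet mulf_neq0 //; apply/prodf_neq0 => i _.
  by rewrite /pdetU HU det1 oner_neq0.
by rewrite /pdetV HV det1 oner_neq0.
Qed.

Lemma stief_feasible h v : fiber chan (offdiag h) v -> feasible d h (stiefel_proj (stief v)).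
Proof.
move=> /fiberP hv; apply/feasible_proj; first exact: stief_stiefel.
by move=> i j ij; rewrite -hv // cH_annihilates.
Qed.

Lemma pdet_units X : pdet X != 0 ->
  (forall i, X.1 i *m (pivE fU C i)^T \in unitmx) /\
  (forall i, X.2 i *m (pivE fV C i)^T \in unitmx).
Proof.
rewrite mulf_eq0 => /norP[/prodf_neq0 HU /prodf_neq0 HV].
by split=> i; rewrite unitmxE unitfE; [apply: HU|apply: HV].
Qed.

Lemma chart_pt_stief h v : fiber chan (offdiag h) v -> chart_pt h (stief v) = v.
Proof.
move=> /fiberP hv; apply: functional_extensionality => k; rewrite /chart_pt.
have [HU HV] := stief_pivot v.
rewrite -[in RHS](enum_valK k); case: (enum_val k) => [[t|t]|t].
- by rewrite /nU HU invmx1 mul1mx chartM_entry.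
- by rewrite /nV HV invmx1 mul1mx chartM_entry.
- by have /andP[tij _] := valP t; rewrite -hv // cH_free.
Qed.

Lemma coord_chart_pt h X t : coord (chart_pt h X) t = 
  match t with
  | inl (inl t) => nU X (tag (val t)) (tagged (val t)).1 (tagged (val t)).2
  | inl (inr t) => nV X (tag (val t)) (tagged (val t)).1 (tagged (val t)).2
  | inr t => h (tag (val t)).1 (tag (val t)).2 (tagged (val t)).1 (tagged (val t)).2
  end.
Proof. by rewrite /coord /chart_pt enum_rankK. Qed.

Lemma cU_chart_pt h X i : pdet X != 0 -> cU (coord (chart_pt h X)) i = nU X i.
Proof.
move=> /pdet_units[uU _]; rewrite /cU -(chartM_coord fU_inj (X := nU X)).
  by congr (chartM _ i); apply: functional_extensionality => t; rewrite coord_chart_pt.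
by move=> j; rewrite /nU -mulmxA mulVmx.
Qed.

Lemma cV_chart_pt h X i : pdet X != 0 -> cV (coord (chart_pt h X)) i = nV X i.
Proof.
move=> /pdet_units[_ uV]; rewrite /cV -(chartM_coord fV_inj (X := nV X)).
  by congr (chartM _ i); apply: functional_extensionality => t; rewrite coord_chart_pt.
by move=> j; rewrite /nV -mulmxA mulVmx.
Qed.

Lemma genmx_unit_mul k l (A : 'M[C]_k) (B : 'M[C]_(k, l)) : A \in unitmx ->
  <<A *m B>>%MS = <<B>>%MS.
Proof. by move=> uA; apply/genmxP/eqmxP/eqmxMfull; rewrite row_full_unit. Qed.

Lemma chart_pt_proj h X : pdet X != 0 ->
  stiefel_proj (stief (chart_pt h X)) = stiefel_proj X.
Proof.
move=> pX; have [uU uV] := pdet_units pX.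
rewrite /stiefel_proj /=; congr Strat; apply: functional_extensionality_dep => i.
  by rewrite cU_chart_pt // genmx_unit_mul // unitmx_inv.
by rewrite cV_chart_pt // genmx_unit_mul // unitmx_inv.
Qed.

Lemma chart_pt_fiber h X : is_stiefel X -> pdet X != 0 ->
  feasible d h (stiefel_proj X) -> fiber chan (offdiag h) (chart_pt h X).
Proof.
move=> sX pX /(feasible_proj h sX) ann; apply/fiberP => i j ij.
apply: cH_coord => // [|t]; last by rewrite coord_chart_pt.
rewrite cU_chart_pt // cV_chart_pt // /nU /nV trmx_mul.
by rewrite !mulmxA -[_ *m _ *m h i j]mulmxA -[_ *m _ *m (X.1 j)^T]mulmxA ann // mulmx0 mul0mx.
Qed.

(** Two bases of a subspace differ by an invertible matrix, which scales the pivot minor and cancels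
    in [nU] and [nV]: chart and coordinates depend on the subspaces alone. *)
Lemma same_proj X X' : is_stiefel X -> stiefel_proj X = stiefel_proj X' ->
  pdet X != 0 -> pdet X' != 0 /\ forall h, chart_pt h X = chart_pt h X'.
Proof.
move=> sX eqX; rewrite mulf_eq0 => /norP[/prodf_neq0 HU /prodf_neq0 HV].
have U i : exists2 g : 'M[C]_(d i), g \in unitmx & X.1 i = g *m X'.1 i.
  by apply: genmx_eq_mul; [case: (sX i)|apply: (congr1 (fun p => SU p i) eqX)].
have V i : exists2 g : 'M[C]_(d i), g \in unitmx & X.2 i = g *m X'.2 i.
  by apply: genmx_eq_mul; [case: (sX i)|apply: (congr1 (fun p => SV p i) eqX)].
have HU' i : pdetU X' i != 0.
  have [g _ XE] := U i; have := HU i isT.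
  by rewrite /pdetU XE -mulmxA det_mulmx mulf_eq0 => /norP[].
have HV' i : pdetV X' i != 0.
  have [g _ XE] := V i; have := HV i isT.
  by rewrite /pdetV XE -mulmxA det_mulmx mulf_eq0 => /norP[].
split; first by rewrite /pdet mulf_neq0 //; apply/prodf_neq0 => i _.
have nUE i : nU X i = nU X' i.
  have [g ug XE] := U i; rewrite /nU XE -mulmxA invmx_mul_cancel // unitmxE unitfE.
  exact: HU'.
have nVE i : nV X i = nV X' i.
  have [g ug XE] := V i; rewrite /nV XE -mulmxA invmx_mul_cancel // unitmxE unitfE.
  exact: HV'.
move=> h; apply: functional_extensionality => k; rewrite /chart_pt.
by case: (enum_val k) => [[t|t]|t]; rewrite ?nUE ?nVE.
Qed.

(* Regular functions on the chart. *)
Definition ratl (f : stiefel -> C) := exists G e, polyfun scoords G /\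
  forall X, pdet X != 0 -> G X = pdet X ^+ e * f X.

Lemma polymx_pivU i : polymx scoords (fun X => X.1 i *m (pivE fU C i)^T).
Proof.
apply: polymx_mul; last exact: polymx_const.
by move=> a b; apply: pf_coord; left; exists i, a, b.
Qed.

Lemma polymx_pivV i : polymx scoords (fun X => X.2 i *m (pivE fV C i)^T).
Proof.
apply: polymx_mul; last exact: polymx_const.
by move=> a b; apply: pf_coord; right; exists i, a, b.
Qed.

Lemma polyfun_pdet : polyfun scoords pdet.
Proof.
apply: pf_mul; apply: polyfun_prod => i _; apply: polyfun_det.
  exact: polymx_pivU.
exact: polymx_pivV.
Qed.

Lemma ratl_const c : ratl (fun=> c).
Proof. by exists (fun=> c), 0%N; split=> [|X _]; [apply: pf_const|rewrite mul1r]. Qed.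

Lemma ratl_add f g : ratl f -> ratl g -> ratl (fun X => f X + g X).
Proof.
move=> [G [e [pG GE]]] [G' [e' [pG' GE']]].
have pX k : polyfun scoords (fun X => pdet X ^+ k).
  elim: k => [|k IH]; first exact: pf_const.
  by apply: polyfun_ext (pf_mul polyfun_pdet IH) _ => X; rewrite exprS.
exists (fun X => pdet X ^+ e' * G X + pdet X ^+ e * G' X), (e + e')%N; split.
  by apply: pf_add; apply: pf_mul.
by move=> X pX0; rewrite GE // GE' // exprD; ring.
Qed.

Lemma ratl_mul f g : ratl f -> ratl g -> ratl (fun X => f X * g X).
Proof.
move=> [G [e [pG GE]]] [G' [e' [pG' GE']]].
exists (fun X => G X * G' X), (e + e')%N; split; first exact: pf_mul.
by move=> X pX0; rewrite GE // GE' // exprD; ring.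
Qed.

(** Cramer's rule: an entry of [nU] or [nV] has one pivot minor as denominator, and the cofactor [p]
    completes it to [pdet], so the exponent 1 is enough. *)
Lemma ratl_quotient k (D : stiefel -> C) (A : stiefel -> 'M[C]_k) (p : stiefel -> C) f :
  polyfun scoords p -> (forall X, pdet X = p X * \det (A X)) ->
  polyfun scoords f ->
  (forall X, pdet X != 0 -> \det (A X) * D X = f X) -> ratl D.
Proof.
move=> pp pE pf DE; exists (fun X => p X * f X), 1%N; split; first exact: pf_mul.
by move=> X pX0; rewrite expr1 pE -mulrA DE.
Qed.

Lemma det_invmx_mul k l (A : 'M[C]_k) (B : 'M[C]_(k, l)) a b : A \in unitmx ->
  \det A * (invmx A *m B) a b = (\adj A *m B) a b.
Proof.
by move=> uA; rewrite /invmx uA -scalemxAl mxE mulrA mulfV ?mul1r //.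
Qed.

Lemma ratl_nU i a b : ratl (fun X => nU X i a b).
Proof.
apply: (@ratl_quotient _ _ (fun X => X.1 i *m (pivE fU C i)^T)
  (fun X => \prod_(j | j != i) pdetU X j * \prod_j pdetV X j)
  (fun X => (\adj (X.1 i *m (pivE fU C i)^T) *m X.1 i) a b)).
- apply: pf_mul; apply: polyfun_prod => j _; apply: polyfun_det.
    exact: polymx_pivU.
  exact: polymx_pivV.
- by move=> X; rewrite /pdet (bigD1 i) //= /pdetU; ring.
- apply: polymx_mul; first exact/polymx_adj/polymx_pivU.
  by move=> a' b'; apply: pf_coord; left; exists i, a', b'.
- by move=> X /pdet_units[uU _]; apply: det_invmx_mul.
Qed.

Lemma ratl_nV i a b : ratl (fun X => nV X i a b).
Proof.
apply: (@ratl_quotient _ _ (fun X => X.2 i *m (pivE fV C i)^T)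
  (fun X => \prod_j pdetU X j * \prod_(j | j != i) pdetV X j)
  (fun X => (\adj (X.2 i *m (pivE fV C i)^T) *m X.2 i) a b)).
- apply: pf_mul; apply: polyfun_prod => j _; apply: polyfun_det.
    exact: polymx_pivU.
  exact: polymx_pivV.
- by move=> X; rewrite /pdet [X in _ * X = _](bigD1 i) //= -/(pdetV X i); ring.
- apply: polymx_mul; first exact/polymx_adj/polymx_pivV.
  by move=> a' b'; apply: pf_coord; right; exists i, a', b'.
- by move=> X /pdet_units[_ uV]; apply: det_invmx_mul.
Qed.

Lemma ratl_chart_pt h (g : {mpoly C[n]}) : ratl (fun X => g.@[chart_pt h X]).
Proof.
have ext f f' : f =1 f' -> ratl f -> ratl f' by move=> /functional_extensionality ->.
elim/mpoly_ring_ind: g => [c|k|p q Hp Hq|p q Hp Hq].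
- by apply: ext (ratl_const c) => X; rewrite mevalC.
- apply: (@ext (fun X => chart_pt h X k)); first by move=> X; rewrite mevalXU.
  rewrite /chart_pt; case: (enum_val k) => [[t|t]|t].
  + exact: ratl_nU.
  + exact: ratl_nV.
  + exact: ratl_const.
- by apply: ext (ratl_add Hp Hq) => X; rewrite mevalD.
- by apply: ext (ratl_mul Hp Hq) => X; rewrite mevalM.
Qed.

Lemma chart_closed_push h (g : {mpoly C[n]}) : exists W, [/\ grass_closed W,
  forall v, fiber chan (offdiag h) v -> (W (stiefel_proj (stief v)) <-> g.@[v] = 0) &
  forall p, feasible d h p -> ~ in_chart p -> W p].
Proof.
have [G [e [pG GE]]] := ratl_chart_pt h g.
(* The factor pdet makes the closed set contain all the points outside the chart. *)
pose G' X := pdet X * G X.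
have G'0 X : pdet X != 0 -> (G' X = 0 <-> g.@[chart_pt h X] = 0).
  move=> pX; rewrite /G' GE // mulrA -exprS; split=> [/eqP|->]; last by rewrite mulr0.
  by rewrite mulf_eq0 expf_eq0 (negPf pX) andbF => /eqP.
(* The function [G'] depends on the bases, but its zero set only on the subspaces: outside the chart
   it vanishes, inside it tests the chart coordinates. *)
have G'inv X X' : is_stiefel X -> is_stiefel X' -> stiefel_proj X = stiefel_proj X' ->
    G' X = 0 -> G' X' = 0.
  move=> sX sX' eqX G'X; have [X'0|X'0] := eqVneq (pdet X') 0; first by rewrite /G' X'0 mul0r.
  have [X0 ptE] := same_proj sX' (esym eqX) X'0.
  by apply/(G'0 _ X'0); rewrite ptE; apply/(G'0 _ X0).
pose W p := is_point d p /\ forall X, is_stiefel X -> stiefel_proj X = p -> G' X = 0.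
have WE X : is_stiefel X -> (W (stiefel_proj X) <-> G' X = 0).
  move=> sX; split=> [[_ H]|G'X]; first exact: H.
  by split=> [|X' sX' eqX]; [exact: stiefel_point|apply: G'inv G'X].
exists W; split.
- split; first by move=> p [].
  exists (fun f => f = G'); split=> [f ->|X sX]; first exact: pf_mul polyfun_pdet pG.
  by split=> [/(WE X sX) ? f ->|H] //; apply/(WE X sX)/H.
- move=> v hv; rewrite -[in g.@[_]](chart_pt_stief hv).
  split=> [/(WE _ (stief_stiefel v))|H]; first by move/(G'0 _ (stief_pdet v)).
  by apply/(WE _ (stief_stiefel v))/(G'0 _ (stief_pdet v)).
- move=> p [pp _] np; split=> // X sX pX; apply: NNPP => /eqP G'X; apply: np.
  by exists X; split=> //; apply: contra_neq G'X => X0; rewrite /G' X0 mul0r.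
Qed.

Lemma polyfun_stief f :
  polyfun scoords f -> exists g : {mpoly C[n]}, forall v, g.@[v] = f (stief v).
Proof.
elim=> {f} [f|c|f g _ [p pE] _ [q qE]|f g _ [p pE] _ [q qE]].
- move=> [[i [a [b ->]]]|[i [a [b ->]]]].
    exists (cU (coord (fun k => 'X_k : {mpoly C[n]})) i a b) => v /=.
    have := map_cU (meval v) (coord (fun k => 'X_k : {mpoly C[n]})) i.
    rewrite (functional_extensionality _ _ (coord_X_meval v)).
    by move/matrixP/(_ a b); rewrite [LHS]mxE.
  exists (cV (coord (fun k => 'X_k : {mpoly C[n]})) i a b) => v /=.
  have := map_cV (meval v) (coord (fun k => 'X_k : {mpoly C[n]})) i.
  rewrite (functional_extensionality _ _ (coord_X_meval v)).
  by move/matrixP/(_ a b); rewrite [LHS]mxE.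
- by exists c%:MP => v; rewrite mevalC.
- by exists (p + q) => v; rewrite mevalD pE qE.
- by exists (p * q) => v; rewrite mevalM pE qE.
Qed.

Lemma chart_closed_pull W : grass_closed W -> exists G : {mpoly C[n]} -> Prop,
  forall v, W (stiefel_proj (stief v)) <-> forall g, G g -> g.@[v] = 0.
Proof.
move=> [_ [Fs [pFs HFs]]].
exists (fun g => exists2 f, Fs f & forall v, g.@[v] = f (stief v)) => v.
split=> [/(HFs _ (stief_stiefel v)) H g [f Ff ->]|H]; first exact: H.
apply/(HFs _ (stief_stiefel v)) => f Ff; have [g gE] := polyfun_stief (pFs f Ff).
by rewrite -gE; apply: H; exists f.
Qed.

Lemma offdiag_polyfun (P : {mpoly C[m]}) :
  polyfun (@hcoords R K M N) (fun h => P.@[offdiag h]).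
Proof.
elim/mpoly_ring_ind: P => [c|k|p q Hp Hq|p q Hp Hq].
- by apply: polyfun_ext (pf_const _ c) _ => h; rewrite mevalC.
- apply: polyfun_ext (pf_coord _) _ => [|h]; last by rewrite mevalXU; reflexivity.
  set t := val (enum_val k); exists (tag t).1, (tag t).2, (tagged t).1, (tagged t).2.
  by split; first exact: (valP (enum_val k)).
- by apply: polyfun_ext (pf_add Hp Hq) _ => h; rewrite mevalD.
- by apply: polyfun_ext (pf_mul Hp Hq) _ => h; rewrite mevalM.
Qed.

Lemma offdiag_onto (b : 'I_m -> C) : exists h, offdiag h = b.
Proof.
pose h : hspace := fun i j => \matrix_(x, y)
  oapp (fun t : offT M N => b (enum_rank t)) 0
    (insub (existT (fun ij : 'I_K * 'I_K => ('I_(N ij.1) * 'I_(M ij.2))%type) (i, j) (x, y))).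
exists h; apply: functional_extensionality => k.
rewrite /offdiag /h mxE -[in RHS](enum_valK k).
case: (enum_val k) => -[[i j] [x y]] /= ij.
by rewrite insubT.
Qed.

(** The upper bound covers only chains whose smallest member meets the chart; the others are left to
    other charts. *)
Theorem chart_generic : generic (fun h =>
  (forall p, feasible d h p -> ~ in_chart p) \/
  exists r, [/\ (r + m = n)%N, irr_chain grass_closed (feasible d h) r &
    forall k (Z : nat -> strat -> Prop) p0,
      (forall i, (i <= k)%N -> irreducible_in grass_closed (feasible d h) (Z i)) ->
      (forall i, (i < k)%N -> psubsetP (Z i) (Z i.+1)) ->
      Z 0%N p0 -> in_chart p0 -> (k <= r)%N]).
Proof.
have [f f0 Hf] := generic_fiber chan.
exists (fun h => f.@[offdiag h]); split; first exact: offdiag_polyfun.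
split.
  by have [b fb] := mpoly_nonroot f0; have [h hb] := offdiag_onto b; exists h; rewrite hb.
have onto h p : feasible d h p -> in_chart p ->
    exists2 v, fiber chan (offdiag h) v & stiefel_proj (stief v) = p.
  move=> fp [X [sX Xp pX]]; exists (chart_pt h X); last by rewrite chart_pt_proj.
  by apply: chart_pt_fiber => //; rewrite Xp.
have into h v : fiber chan (offdiag h) v ->
    feasible d h (stiefel_proj (stief v)) /\ in_chart (stiefel_proj (stief v)).
  move=> hv; split; first exact: stief_feasible.
  by exists (stief v); split=> //; [exact: stief_stiefel|exact: stief_pdet].
have pull W (h : hspace) : grass_closed W -> exists G : {mpoly C[n]} -> Prop,
    forall v, fiber chan (offdiag h) v -> W (stiefel_proj (stief v)) <->
      forall g, G g -> g.@[v] = 0.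
  by move=> /chart_closed_pull[G HG]; exists G => v _.
move=> h /Hf[nofib|[r [rm ind [Z [HZ sZ]]]]].
  by left=> p fp /(onto h p fp)[v /nofib].
right; exists r; split=> //.
  exact: (push_chain (@grass_closed_bigcap R K d M N) (into h) (fun W => @pull W h)
    (chart_closed_push h) HZ sZ).
move=> k Z' p0 HZ' sZ' Z'p0 p0c.
exact: (chain_length_le (@grass_closed_bigcap R K d M N) (onto h) (fun W => @pull W h)
  (chart_closed_push h) ind HZ' sZ' Z'p0 p0c).
Qed.
End Chart.

(** * The feasibility theorem *)

Section GenericProps.
Variables (R : realType) (K : nat) (M N : 'I_K -> nat).
Local Notation C := (R[i]).
Local Notation hspace := (hspace R M N).
Local Notation hcoords := (@hcoords R K M N).
Implicit Types P Q : hspace -> Prop.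

Lemma generic_mono P Q : generic P -> (forall h, P h -> Q h) -> generic Q.
Proof. by move=> [f [pf [f0 fP]]] PQ; exists f; split=> //; split=> // h /fP/PQ. Qed.

Lemma generic_all P : (forall h, P h) -> generic P.
Proof.
move=> allP; exists (fun=> 1); split; first exact: pf_const.
by split=> [|h _]; [exists (fun _ _ => 0); apply: oner_neq0|apply: allP].
Qed.

Lemma polyfun_line (h h' : hspace) f : polyfun hcoords f ->
  exists p : {poly C}, forall t, p.[t] = f (fun i j => h i j + t *: (h' i j - h i j)).
Proof.
elim=> {f} [f [i [j [a [b [_ ->]]]]]|c|f g _ [p pE] _ [q qE]|f g _ [p pE] _ [q qE]].
- exists ((h i j a b)%:P + 'X * (h' i j a b - h i j a b)%:P) => t.
  by rewrite !hornerE !mxE.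
- by exists c%:P => t; rewrite hornerC.
- by exists (p + q) => t; rewrite hornerD pE qE.
- by exists (p * q) => t; rewrite hornerM pE qE.
Qed.

(** On the line joining a nonzero of [f] to a nonzero of [g] both are nonzero univariate
    polynomials, which share a nonroot. *)
Lemma generic_and P Q : generic P -> generic Q -> generic (fun h => P h /\ Q h).
Proof.
move=> [f [pf [[h fh] fP]]] [g [pg [[h' gh'] gQ]]].
exists (fun x => f x * g x); split; first exact: pf_mul.
split; last by move=> x; rewrite mulf_eq0 => /norP[/fP ? /gQ ?].
have [p pE] := polyfun_line h h' pf; have [q qE] := polyfun_line h h' pg.
have line0 : (fun i j => h i j + 0 *: (h' i j - h i j)) = h.
  apply: functional_extensionality_dep => i; apply: functional_extensionality_dep => j.
  by rewrite scale0r addr0.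
have line1 : (fun i j => h i j + 1 *: (h' i j - h i j)) = h'.
  apply: functional_extensionality_dep => i; apply: functional_extensionality_dep => j.
  by rewrite scale1r addrC subrK.
have p0 : p != 0 by apply: contra_neq fh => p0; rewrite -line0 -pE p0 horner0.
have q0 : q != 0 by apply: contra_neq gh' => q0; rewrite -line1 -qE q0 horner0.
have [t] := poly_nonroot (mulf_neq0 p0 q0).
by rewrite hornerM pE qE; exists (fun i j => h i j + t *: (h' i j - h i j)).
Qed.

Lemma generic_forall (I : finType) (P : I -> hspace -> Prop) :
  (forall i, generic (P i)) -> generic (fun h => forall i, P i h).
Proof.
move=> gP; suff : generic (fun h => forall i, i \in enum I -> P i h).
  by move/generic_mono; apply=> h H i; apply: H; rewrite mem_enum.
elim: (enum I) => [|i s IH]; first exact: generic_all.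
apply: generic_mono (generic_and (gP i) IH) _ => h [Pi Ps] j.
by rewrite inE => /orP[/eqP ->|/Ps].
Qed.

(** The polynomial is the leading minor of order [minn (N i) (M j)], equal to 1 at the rectangular
    identity. *)
Lemma generic_full_rank i j : i != j ->
  generic (fun h : hspace => (minn (N i) (M j) <= \rank (h i j))%N).
Proof.
move=> ij; set q := minn _ _.
pose A : 'M[C]_(q, N i) := pid_mx q; pose B : 'M[C]_(M j, q) := pid_mx q.
exists (fun h => \det (A *m h i j *m B)); split.
  apply: polyfun_det; apply: polymx_mul; last exact: polymx_const.
  apply: polymx_mul; first exact: polymx_const.
  by move=> a b; apply: pf_coord; exists i, j, a, b.
split.
  exists (fun i j => pid_mx q); rewrite /A /B pid_mx_id ?geq_minl //.
  by rewrite pid_mx_id ?geq_minr // pid_mx_1 det1 oner_neq0.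
move=> h; rewrite -unitfE -unitmxE -row_free_unit => /eqP {1}<-.
by apply: leq_trans (mxrankM_maxl _ _) _; apply: mxrankM_maxr.
Qed.
End GenericProps.

Lemma pivot_exists (F : fieldType) k l (B : 'M[F]_(k, l)) : row_free B ->
  exists2 f : 'I_k -> 'I_l, injective f &
    \det (B *m (\matrix_(a, b) (b == f a)%:R)^T) != 0.
Proof.
move=> fB; have full : row_full B^T by rewrite /row_full mxrank_tr.
exists (fullrankfun full); first exact: fullrankfun_inj.
have := fullrowsub_unit full; rewrite unitmxE unitfE -det_tr; congr (\det _ != 0).
apply/matrixP => a b; rewrite !mxE (bigD1 (fullrankfun full b)) //= !mxE eqxx mulr1.
by rewrite big1 ?addr0 // => c cb; rewrite !mxE (negPf cb) mulr0.
Qed.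

Section Dimension.
Variables (R : realType) (K : nat) (d M N : 'I_K -> nat).
Local Notation C := (R[i]).
Local Notation hspace := (hspace R M N).
Local Notation stiefel := (stiefel R d M N).

(** A finite type, so that [generic_forall] treats all charts at once; injectivity is stated
    apart. *)
Definition pivots := {dffun forall i : 'I_K,
  ({ffun 'I_(d i) -> 'I_(M i)} * {ffun 'I_(d i) -> 'I_(N i)})%type}.
Definition pivots_inj (c : pivots) :=
  (forall i, injective (c i).1) /\ (forall i, injective (c i).2).

Lemma chart_cover (X : stiefel) : is_stiefel X -> exists2 c : pivots, pivots_inj c &
  in_chart (fun i => (c i).1) (fun i => (c i).2) (stiefel_proj X).
Proof.
move=> sX.
have piv i : exists c : {ffun 'I_(d i) -> 'I_(M i)} * {ffun 'I_(d i) -> 'I_(N i)},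
    [/\ injective c.1, injective c.2,
        \det (X.1 i *m (\matrix_(a, b) (b == c.1 a)%:R)^T) != 0 &
        \det (X.2 i *m (\matrix_(a, b) (b == c.2 a)%:R)^T) != 0].
  have [fX gX] := sX i; have [f fi fd] := pivot_exists fX; have [g gi gd] := pivot_exists gX.
  exists (finfun f, finfun g) => /=; split.
  - by move=> a b; rewrite !ffunE => /fi.
  - by move=> a b; rewrite !ffunE => /gi.
  - by move: fd; congr (\det (_ *m _^T) != 0); apply/matrixP => a b; rewrite !mxE ffunE.
  - by move: gd; congr (\det (_ *m _^T) != 0); apply/matrixP => a b; rewrite !mxE ffunE.
have [c Hc] := fin_all_exists piv.
exists (finfun c : pivots); first by split=> i; rewrite ffunE; case: (Hc i).
exists X; split=> //; rewrite /pdet mulf_neq0 //; apply/prodf_neq0 => i _.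
  by rewrite /pdetU /pivE ffunE; case: (Hc i).
by rewrite /pdetV /pivE ffunE; case: (Hc i).
Qed.

Lemma point_dim (p : strat R M N) : is_point d p -> forall i, (d i <= minn (M i) (N i))%N.
Proof.
move=> pp i; have [[_ rU] [_ rV]] := pp i.
by rewrite leq_min; apply/andP; split; [rewrite -rU|rewrite -rV]; apply: rank_leq_row.
Qed.

Lemma expected_dimE r m : (forall i, d i <= minn (M i) (N i))%N ->
  (r + m + \sum_i \sum_(j | j != i) d i * d j =
    \sum_i d i * (M i - d i) + \sum_i d i * (N i - d i) + m)%N ->
  expected_dim d M N = r%:Z.
Proof.
move=> dle rE; rewrite /expected_dim /tA.
have E1 : \sum_(i in [set: 'I_K]) ((d i)%:Z * ((N i)%:Z - (d i)%:Z) +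
      (d i)%:Z * ((M i)%:Z - (d i)%:Z)) =
    (\sum_i d i * (M i - d i) + \sum_i d i * (N i - d i))%N%:Z.
  rewrite -big_split /= (big_morph Posz PoszD (erefl 0%:Z)).
  apply: eq_big => [i|i _]; first by rewrite inE.
  have := dle i; rewrite leq_min => /andP[dM dN].
  by rewrite PoszD !PoszM -!subzn // addrC.
have E2 : \sum_(i in [set: 'I_K]) \sum_(j in [set: 'I_K] | j != i) (d i)%:Z * (d j)%:Z =
    (\sum_i \sum_(j | j != i) d i * d j)%N%:Z.
  rewrite (big_morph Posz PoszD (erefl 0%:Z)); apply: eq_big => [i|i _]; first by rewrite inE.
  rewrite (big_morph Posz PoszD (erefl 0%:Z)); apply: eq_big => [j|j _]; first by rewrite inE.
  by rewrite PoszM.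
rewrite E1 E2; move: rE; clear.
move: (\sum_i _ * (M i - _))%N (\sum_i _ * (N i - _))%N (\sum_i \sum_(j | _) _)%N => x y z.
lia.
Qed.

Theorem generic_dim : generic (fun h : hspace =>
  nonemptyP (feasible d h) -> variety_dim d (feasible d h) (expected_dim d M N)).
Proof.
pose P (c : pivots) (h : hspace) := pivots_inj c ->
  (forall p, feasible d h p -> ~ in_chart (fun i => (c i).1) (fun i => (c i).2) p) \/
  exists r, [/\ (r + #|{: offT M N}| = #|{: coordT (fun i => (c i).1) (fun i => (c i).2)}|)%N,
    irr_chain (@grass_closed R K d M N) (feasible d h) r &
    forall k (Z : nat -> strat R M N -> Prop) p0,
      (forall i, (i <= k)%N -> irreducible_in (@grass_closed R K d M N) (feasible d h) (Z i)) ->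
      (forall i, (i < k)%N -> psubsetP (Z i) (Z i.+1)) ->
      Z 0%N p0 -> in_chart (fun i => (c i).1) (fun i => (c i).2) p0 -> (k <= r)%N].
have gP : generic (fun h => forall c, P c h).
  apply: generic_forall => c; have [[c1 c2]|nc] := classic (pivots_inj c).
    by apply: generic_mono (chart_generic R c1 c2) _ => h Ph _.
  by apply: generic_all => h /nc.
apply: generic_mono gP _ => h Ph [p fp].
have chart_of q : feasible d h q -> exists2 c : pivots, pivots_inj c &
    in_chart (fun i => (c i).1) (fun i => (c i).2) q.
  by move=> [pq _]; have [X sX <-] := stiefel_projP pq; apply: chart_cover.
have dimE (c : pivots) r : pivots_inj c ->
    (r + #|{: offT M N}| = #|{: coordT (fun i => (c i).1) (fun i => (c i).2)}|)%N ->
    expected_dim d M N = r%:Z.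
  move=> [c1 c2] rE; apply: (@expected_dimE r #|{: offT M N}|); first by apply: point_dim fp.1.
  by rewrite rE (card_coordT c1 c2).
have [c cinj pc] := chart_of p fp.
have [/(_ p fp)//|[r [rE rchain _]]] := Ph c cinj.
exists r; split; first exact: dimE rE.
split=> // -[Z [HZ sZ]].
(* A longer chain is read on a chart around a point of its smallest member. This chart may differ
   from the first, but its [r'] is the same expected dimension. *)
have [[W [_ Z0E]] [[p0 Z0p0] _]] := HZ 0%N isT.
have fp0 : feasible d h p0 by case/Z0E: Z0p0.
have [c' cinj' p0c'] := chart_of p0 fp0.
have [/(_ p0 fp0)//|[r' [rE' _ len]]] := Ph c' cinj'.
have := len r.+1 Z p0 HZ sZ Z0p0 p0c'.
have [<-] : r%:Z = r'%:Z by rewrite -(dimE c r) // -(dimE c' r').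
by rewrite ltnn.
Qed.
End Dimension.

(** * Necessary conditions on the dimensions *)

Section Necessary.
Variables (R : realType) (K : nat) (d M N : 'I_K -> nat).
Local Notation C := (R[i]).
Local Notation hspace := (hspace R M N).

Definition dim_on (A : {set 'I_K}) i := if i \in A then d i else 0%N.

Lemma feasible_on A (h : hspace) :
  nonemptyP (feasible d h) -> nonemptyP (feasible (dim_on A) h).
Proof.
move=> [p [pp fp]].
exists (Strat (fun i => if i \in A then SU p i else 0) (fun i => if i \in A then SV p i else 0)).
split=> [i|i j ij v u] /=.
  rewrite /dim_on; case: ifP => _; first exact: pp.
  by rewrite !genmx0 !mxrank0.
case: ifP => _; last by rewrite submx0 => /eqP -> _; rewrite !mul0mx.
case: ifP => _; last by move=> _; rewrite submx0 => /eqP ->; rewrite trmx0 mulmx0.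
exact: fp.
Qed.

Lemma expected_dim_on A : expected_dim (dim_on A) M N = tA d M N A.
Proof.
rewrite /expected_dim /tA; congr (_ - _).
  rewrite [RHS]big_mkcond; apply: eq_big => [i|i _]; first by rewrite inE.
  by rewrite /dim_on; case: ifP => // _; rewrite !mul0r.
rewrite [RHS]big_mkcond; apply: eq_big => [i|i _]; first by rewrite inE.
case: ifP => iA; last by rewrite big1 // => j _; rewrite /dim_on iA mul0r.
rewrite [RHS]big_mkcond [LHS]big_mkcond; apply: eq_bigr => j _.
rewrite inE /= /dim_on iA; case: (j \in A) => //=.
by rewrite mulr0 if_same.
Qed.

(** Sylvester's inequality gives [h i j *m (SU p j)^T] rank at least [rank h + d j - M j], and being
    killed by [SV p i] bounds it by [N i - d i]. With full rank, [N i + M j] minus the minimum is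
    the maximum. *)
Lemma feasible_rank (h : hspace) i j : i != j -> (minn (N i) (M j) <= \rank (h i j))%N ->
  nonemptyP (feasible d h) -> (d i + d j <= maxn (N i) (M j))%N.
Proof.
move=> ij rk [p [pp fp]].
have [_ [_ rV]] := pp i; have [[_ rU] _] := pp j.
have ann : SV p i *m (h i j *m (SU p j)^T) = 0.
  rewrite mulmxA; apply/matrixP => a b.
  have := fp i j ij (row a (SV p i)) (row b (SU p j)) (row_sub _ _) (row_sub _ _).
  by move/matrixP/(_ 0 0); rewrite mul_row_entry !mxE.
have := mulmx0_rank_max ann; rewrite rV.
have := mxrank_mul_min (h i j) (SU p j)^T; rewrite mxrank_tr rU; move: rk.
move: (\rank (h i j *m _)) (\rank (h i j)) => x y; move: (N i) (M j) (d i) (d j) => *; lia.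
Qed.
End Necessary.

Theorem theorem2 (R : realType) (K : nat) (d M N : 'I_K -> nat) :
  (1 <= K)%N ->
  (forall i, 0 < d i)%N -> (forall i, 0 < M i)%N -> (forall i, 0 < N i)%N ->
  @generic R K M N (fun h =>
    let Fh := @feasible R K d M N h in
    (* (1) *)
    ((@nonemptyP (@strat R K M N) Fh -> @variety_dim R K d M N Fh (@expected_dim K d M N)) /\
     (@expected_dim K d M N < 0 -> ~ @nonemptyP (@strat R K M N) Fh)) /\
    (* (2) *)
    (@nonemptyP (@strat R K M N) Fh ->
       (forall i, d i <= minn (M i) (N i))%N /\
       (forall i j, i != j -> d i + d j <= maxn (N i) (M j))%N /\
       (forall A : {set 'I_K}, 0 <= @tA K d M N A))).
Proof.
move=> _ _ _ _.
have gsub : generic (fun h : hspace R M N => forall A : {set 'I_K},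
    nonemptyP (feasible (dim_on d A) h) ->
    variety_dim (dim_on d A) (feasible (dim_on d A) h) (expected_dim (dim_on d A) M N)).
  by apply: generic_forall => A; apply: generic_dim.
have grank : generic (fun h : hspace R M N => forall i j : 'I_K, i != j ->
    (minn (N i) (M j) <= \rank (h i j))%N).
  apply: generic_forall => i.
  apply: (@generic_forall R K M N _ (fun j h => i != j -> _ <= _)%N) => j.
  case: (eqVneq i j) => ij; first exact: generic_all.
  by apply: generic_mono (generic_full_rank R M N ij) _.
apply: generic_mono (generic_and (generic_dim R d M N) (generic_and gsub grank)) _.
(* A dimension is a natural number: this gives both emptiness for a negative value and the sign of
   each [tA]. *)
move=> h [Hdim [Hsub Hrank]] /=; split; first split=> // neg Fh.
  by have [r [rE _]] := Hdim Fh; rewrite rE in neg.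
move=> Fh; split; [|split=> [i j ij|A]].
- by case: (Fh) => p [pp _]; apply: point_dim pp.
- exact: feasible_rank (Hrank i j ij) Fh.
- by have [r [rE _]] := Hsub A (feasible_on A Fh); rewrite -expected_dim_on rE.
Qed.
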